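(* Let $k$ be a field, let $G$ be a group, let $\mathcal{C}$ be a $G$-$k$-category with a free action of $G$, and let $\mathcal{C}[G]$ be the $G$-graded skew category. There is an isomorphism of $k$-algebras $$HH^*_{\{1\}}(\mathcal{C}[G])\simeq H^*\left(C^\bullet(\mathcal{C})^G\right).$$ If the invariants functor $M\mapsto M^G$ on $kG$-modules is exact, there is an isomorphism of $k$-algebras $$HH^*_{\{1\}}(\mathcal{C}[G])\simeq HH^*(\mathcal{C})^G.$$
   Context: A $k$-category is a small category enriched over $k$-vector spaces; the space of morphisms from $x$ to $y$ is denoted ${}_y\mathcal{C}_x$ and the set of objects $\mathcal{C}_0$. A $G$-$k$-category is a $k$-category with an action of $G$ by $k$-isomorphisms of $\mathcal{C}$: $G$ acts on $\mathcal{C}_0$, and each $s\in G$ gives $k$-linear maps ${}_y\mathcal{C}_x\to{}_{sy}\mathcal{C}_{sx}$, $f\mapsto sf$, compatible with composition and identities, with $t(sf)=(ts)f$. The action is free if it is free on objects: $sx=x$ with $x\in\mathcal{C}_0$ only holds if $s=1$. The Hochschild-Mitchell cohomology $HH^*(\mathcal{C})$ is the cohomology of the cochain complex $C^\bullet(\mathcal{C})$ with $C^0(\mathcal{C})=\prod_{x\in\mathcal{C}_0}{}_x\mathcal{C}_x$ and, for $n>0$, $$C^n(\mathcal{C})=\prod_{x_{n+1},\dots,x_1\in\mathcal{C}_0}\mathrm{Hom}_k\left({}_{x_{n+1}}\mathcal{C}_{x_n}\otimes\cdots\otimes{}_{x_2}\mathcal{C}_{x_1},\ {}_{x_{n+1}}\mathcal{C}_{x_1}\right),$$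 with the usual Hochschild coboundary $$(d\varphi)(f_{n+1}\otimes\cdots\otimes f_1)=(-1)^{n+1}f_{n+1}\varphi(f_n\otimes\cdots\otimes f_1)+\sum_{i=1}^n(-1)^i\varphi(f_{n+1}\otimes\cdots\otimes f_{i+1}f_i\otimes\cdots\otimes f_1)+\varphi(f_{n+1}\otimes\cdots\otimes f_2)f_1.$$ The cup product $(\psi\smile\varphi)(f_{n+m}\otimes\cdots\otimes f_1)=\psi(f_{n+m}\otimes\cdots\otimes f_{n+1})\varphi(f_n\otimes\cdots\otimes f_1)$ (for $\psi,\varphi$ of degrees $m,n$) makes $C^\bullet(\mathcal{C})$ a differential graded algebra and $HH^*(\mathcal{C})$ a graded algebra. The group $G$ acts on $C^\bullet(\mathcal{C})$ by automorphisms of differential graded algebras: for $n>0$, the component of $s.\varphi$ at $(sx_{n+1},\dots,sx_1)$ is $f_n\otimes\cdots\otimes f_1\mapsto s[\varphi_{(x_{n+1},\dots,x_1)}(s^{-1}f_n\otimes\cdots\otimes s^{-1}f_1)]$, and for $n=0$ the component of $s.\varphi$ at $sx$ is $s\varphi_x$. Hence $G$ acts on $HH^*(\mathcal{C})$ by algebra automorphisms. For a $kG$-module $M$, $M^G=\{m\in M\mid sm=m\ \text{for all } s\in G\}$. The skew category $\mathcal{C}[G]$ has the same objects as $\mathcal{C}$, with ${}_y\mathcal{C}[G]_x=\bigoplus_{s\in G}{}_y\mathcal{C}[G]_x^s$, where ${}_y\mathcal{C}[G]_x^s={}_y\mathcal{C}_{sx}$. For $f\in{}_y\mathcal{C}_{sx}$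 (degree $s$) and $g\in{}_z\mathcal{C}_{ty}$ (degree $t$), $gf=g\circ(tf)\in{}_z\mathcal{C}_{tsx}$ (degree $ts$), where $\circ$ is the composition of $\mathcal{C}$. It is a $G$-graded $k$-category: ${}_z\mathcal{B}_y^t\,{}_y\mathcal{B}_x^s\subset{}_z\mathcal{B}_x^{ts}$ for $\mathcal{B}=\mathcal{C}[G]$. For a $G$-graded $k$-category $\mathcal{B}$, $HH^*_{\{1\}}(\mathcal{B})$ (trivial conjugacy class $\{1\}$) is the cohomology of the sub differential graded algebra $C^\bullet_{\{1\}}(\mathcal{B})$ of $C^\bullet(\mathcal{B})$ consisting of the cochains $\varphi$ whose components send ${}_{x_{n+1}}\mathcal{B}^{s_n}_{x_n}\otimes\cdots\otimes{}_{x_2}\mathcal{B}^{s_1}_{x_1}$ into ${}_{x_{n+1}}\mathcal{B}^{s_n\cdots s_1}_{x_1}$ (for $n=0$: $\varphi_x\in{}_x\mathcal{B}^1_x$). *)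

(* Defs.v *)
From HB Require Import structures.
From mathcomp Require Import all_boot all_order all_algebra.
From mathcomp Require Import finmap boolp classical_sets functions cardinality fsbigop.

Set Implicit Arguments.
Unset Strict Implicit.
Unset Printing Implicit Defensive.

Import GRing.Theory.
Local Open Scope ring_scope.

Section LinearAlgebra.
Variable k : fieldType.

Definition dprod (I : Type) (V : I -> lmodType k) : Type := forall i, V i.

Section Dprod.
Variables (I : Type) (V : I -> lmodType k).
Implicit Types f g h : dprod V.

HB.instance Definition _ := gen_eqMixin (dprod V).
HB.instance Definition _ := gen_choiceMixin (dprod V).

Let addp f g : dprod V := fun i => f i + g i.
Let oppp f : dprod V := fun i => - f i.
Let zerop : dprod V := fun i => 0.
Let scalep (a : k) f : dprod V := fun i => a *: f i.

Fact dprod_addA : associative addp.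
Proof. by move=> f g h; apply: functional_extensionality_dep => i; apply: addrA. Qed.
Fact dprod_addC : commutative addp.
Proof. by move=> f g; apply: functional_extensionality_dep => i; apply: addrC. Qed.
Fact dprod_add0 : left_id zerop addp.
Proof. by move=> f; apply: functional_extensionality_dep => i; apply: add0r. Qed.
Fact dprod_addN : left_inverse zerop oppp addp.
Proof. by move=> f; apply: functional_extensionality_dep => i; apply: addNr. Qed.

HB.instance Definition _ := GRing.isZmodule.Build (dprod V)
  dprod_addA dprod_addC dprod_add0 dprod_addN.

Fact dprod_scaleA a b f : scalep a (scalep b f) = scalep (a * b) f.
Proof. by apply: functional_extensionality_dep => i; apply: scalerA. Qed.
Fact dprod_scale1 : left_id 1 scalep.
Proof. by move=> f; apply: functional_extensionality_dep => i; apply: scale1r. Qed.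
Fact dprod_scaleDr : right_distributive scalep +%R.
Proof. by move=> a f g; apply: functional_extensionality_dep => i; apply: scalerDr. Qed.
Fact dprod_scaleDl f : {morph scalep^~ f : a b / a + b}.
Proof. by move=> a b; apply: functional_extensionality_dep => i; apply: scalerDl. Qed.

HB.instance Definition _ := GRing.Zmodule_isLmodule.Build k (dprod V)
  dprod_scaleA dprod_scale1 dprod_scaleDr dprod_scaleDl.

Lemma dprodDE f g i : (f + g) i = f i + g i. Proof. by []. Qed.
Lemma dprodZE a f i : (a *: f) i = a *: f i. Proof. by []. Qed.
Lemma dprodPE a f g i : (a *: f + g) i = a *: f i + g i. Proof. by []. Qed.
Lemma dprod0E i : (0 : dprod V) i = 0. Proof. by []. Qed.
End Dprod.

Record submod (V : lmodType k) := Submod {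
  in_submod :> V -> Prop;
  submod0 : in_submod 0;
  submodP : forall a u v, in_submod u -> in_submod v -> in_submod (a *: u + v)
}.

Section SubQuot.
Variables (V : lmodType k) (S : submod V).

Lemma submodD u v : S u -> S v -> S (u + v).
Proof. by move=> Su Sv; rewrite -[u]scale1r; apply: submodP. Qed.
Lemma submodZ a u : S u -> S (a *: u).
Proof. by move=> Su; rewrite -[_ *: _]addr0; apply: submodP => //; apply: submod0. Qed.
Lemma submodN u : S u -> S (- u).
Proof. by move=> Su; rewrite -scaleN1r; apply: submodZ. Qed.

Definition submod_pred : {pred V} := fun v => `[< S v >].

Fact submod_pred_closed : GRing.subsemimod_closed submod_pred.
Proof.
split; first split.
- by apply/asboolP; apply: submod0.
- by move=> u v /asboolP Su /asboolP Sv; apply/asboolP; apply: submodD.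
- by move=> a u /asboolP Su; apply/asboolP; apply: submodZ.
Qed.
HB.instance Definition _ := GRing.isSubmodClosed.Build k V submod_pred
  submod_pred_closed.

Record subm : Type := Subm { subm_val : V; _ : subm_val \in submod_pred }.
HB.instance Definition _ := [isSub for subm_val].
HB.instance Definition _ := [Choice of subm by <:].
HB.instance Definition _ := [SubChoice_isSubLmodule of subm by <:].

Lemma subm_in (u : subm) : S (subm_val u).
Proof. by apply/asboolP; apply: (valP u). Qed.

Fact mksub_subproof v : S v -> v \in submod_pred.
Proof. by move=> Sv; apply/asboolP. Qed.
Definition mksub v (Sv : S v) : subm := Subm (mksub_subproof Sv).

Lemma mksubE v (Sv : S v) : subm_val (mksub Sv) = v.
Proof. by []. Qed.
Lemma subm_valP a (u v : subm) : subm_val (a *: u + v) = a *: subm_val u + subm_val v.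
Proof. exact: linearP (\val : subm -> V) a u v. Qed.
Lemma subm_valD (u v : subm) : subm_val (u + v) = subm_val u + subm_val v.
Proof. exact: linearD (\val : subm -> V) u v. Qed.
Lemma subm_valZ a (u : subm) : subm_val (a *: u) = a *: subm_val u.
Proof. exact: linearZZ (\val : subm -> V) a u. Qed.
Lemma subm_valB (u v : subm) : subm_val (u - v) = subm_val u - subm_val v.
Proof. exact: linearB (\val : subm -> V) u v. Qed.

Lemma subm_inj (u v : subm) : subm_val u = subm_val v -> u = v.
Proof. exact: val_inj. Qed.

Definition quotm : Type := Quotient.quot submod_pred.
HB.instance Definition _ := Choice.on quotm.
HB.instance Definition _ := GRing.Zmodule.on quotm.

Definition cls (v : V) : quotm := (\pi_(Quotient.quot submod_pred) v)%qT.
Definition rep (x : quotm) : V := (@repr _ (Quotient.quot submod_pred) x).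

Lemma repK x : cls (rep x) = x.
Proof. exact: (@reprK _ (Quotient.quot submod_pred) x). Qed.

Lemma clsP u v : cls u = cls v <-> S (u - v).
Proof.
split.
- move=> /eqP; rewrite /cls.
  by rewrite -Quotient.idealrBE => /asboolP.
- move=> Suv; apply/eqP; rewrite /cls.
  by rewrite -Quotient.idealrBE; apply/asboolP.
Qed.

Lemma clsD u v : cls (u + v) = cls u + cls v.
Proof. exact: Quotient.pi_add. Qed.

Lemma rep_cls v : S (rep (cls v) - v).
Proof. by apply/clsP; rewrite repK. Qed.

Definition scaleq (a : k) (x : quotm) : quotm := cls (a *: rep x).

Lemma scaleqE a v : scaleq a (cls v) = cls (a *: v).
Proof. by apply/clsP; rewrite -scalerBr; apply/submodZ/rep_cls. Qed.

Fact scaleqA a b x : scaleq a (scaleq b x) = scaleq (a * b) x.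
Proof. by rewrite -[x]repK !scaleqE scalerA. Qed.
Fact scaleq1 : left_id 1 scaleq.
Proof. by move=> x; rewrite -[x]repK scaleqE scale1r. Qed.
Fact scaleqDr : right_distributive scaleq +%R.
Proof. by move=> a x y; rewrite -[x]repK -[y]repK -clsD !scaleqE scalerDr clsD. Qed.
Fact scaleqDl x : {morph scaleq^~ x : a b / a + b}.
Proof. by move=> a b; rewrite -[x]repK !scaleqE scalerDl clsD. Qed.
HB.instance Definition _ := GRing.Zmodule_isLmodule.Build k quotm
  scaleqA scaleq1 scaleqDr scaleqDl.

Lemma cls_is_linear a u v : cls (a *: u + v) = a *: cls u + cls v.
Proof. by rewrite clsD -scaleqE. Qed.
HB.instance Definition _ := GRing.isLinear.Build k V quotm _ cls cls_is_linear.
End SubQuot.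
End LinearAlgebra.

Definition gcast (k : fieldType) (A : nat -> lmodType k) m n (e : m = n)
    (a : A m) : A n :=
  match e in _ = p return A p with erefl => a end.

Section GradedAlgebras.
Variable k : fieldType.

Record galg := GAlg {
  gcomp :> nat -> lmodType k;
  gmul : forall m n, gcomp m -> gcomp n -> gcomp (m + n)%N;
  gone : gcomp 0%N;
  gmulPl : forall m n c (a b : gcomp m) (x : gcomp n),
    gmul (c *: a + b) x = c *: gmul a x + gmul b x;
  gmulPr : forall m n c (x : gcomp m) (a b : gcomp n),
    gmul x (c *: a + b) = c *: gmul x a + gmul x b;
  gmulA : forall m n p (a : gcomp m) (b : gcomp n) (c : gcomp p),
    gcast (addnA m n p) (gmul a (gmul b c)) = gmul (gmul a b) c;
  gmul1l : forall n (a : gcomp n), gmul gone a = a;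
  gmul1r : forall n (a : gcomp n), gcast (addn0 n) (gmul a gone) = a
}.

(* An isomorphism of graded algebras, given degree by degree. *)
Definition galg_isom (A B : galg) : Prop :=
  exists f : forall n, {linear gcomp A n -> gcomp B n},
    [/\ forall n, bijective (f n),
        f 0%N (gone A) = gone B &
        forall m n (a : A m) (b : A n),
          f (m + n)%N (gmul a b) = gmul (f m a) (f n b)].

Lemma gcastD (A : nat -> lmodType k) m n (e : m = n) (a b : A m) :
  gcast e (a + b) = gcast e a + gcast e b.
Proof. by case: n / e. Qed.
Lemma gcastP (A : nat -> lmodType k) m n (e : m = n) c (a b : A m) :
  gcast e (c *: a + b) = c *: gcast e a + gcast e b.
Proof. by case: n / e. Qed.
Lemma gcast0 (A : nat -> lmodType k) m n (e : m = n) : gcast e (0 : A m) = 0.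
Proof. by case: n / e. Qed.
Lemma gcastK (A : nat -> lmodType k) m n (e : m = n) : cancel (@gcast k A m n e) (gcast (esym e)).
Proof. by case: n / e. Qed.
Lemma gcast_id (A : nat -> lmodType k) m (e : m = m) (a : A m) : gcast e a = a.
Proof. by rewrite (Prop_irrelevance e erefl). Qed.

Section GAlgTheory.
Variable A : galg.
Lemma gmulDl m n (a b : A m) (x : A n) : gmul (a + b) x = gmul a x + gmul b x.
Proof. by rewrite -[a]scale1r gmulPl !scale1r. Qed.
Lemma gmul0l m n (x : A n) : gmul (0 : A m) x = 0.
Proof. by apply: (addIr (gmul 0 x)); rewrite -gmulDl addr0 add0r. Qed.
Lemma gmulZl m n c (a : A m) (x : A n) : gmul (c *: a) x = c *: gmul a x.
Proof. by rewrite -[c *: a]addr0 gmulPl gmul0l addr0. Qed.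
Lemma gmulDr m n (a b : A m) (x : A n) : gmul x (a + b) = gmul x a + gmul x b.
Proof. by rewrite -[a]scale1r gmulPr !scale1r. Qed.
Lemma gmul0r m n (x : A n) : gmul x (0 : A m) = 0.
Proof. by apply: (addIr (gmul x 0)); rewrite -gmulDr addr0 add0r. Qed.
Lemma gmulZr m n c (a : A m) (x : A n) : gmul x (c *: a) = c *: gmul x a.
Proof. by rewrite -[c *: a]addr0 gmulPr gmul0r addr0. Qed.
End GAlgTheory.

Record sub_galg (A : galg) := SubGAlg {
  sg :> forall n, submod (gcomp A n);
  sg1 : sg 0%N (gone A);
  sgM : forall m n (a : A m) (b : A n), sg m a -> sg n b -> sg (m + n)%N (gmul a b)
}.

Section SubGAlgebra.
Variables (A : galg) (S : sub_galg A).

Definition sg_mul m n (a : subm (S m)) (b : subm (S n)) : subm (S (m + n)%N) :=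
  mksub (sgM (subm_in a) (subm_in b)).
Definition sg_one : subm (S 0%N) := mksub (sg1 S).

Lemma val_gcast m n (e : m = n) (a : subm (S m)) :
  subm_val (gcast (A := fun i => subm (S i)) e a) = gcast e (subm_val a).
Proof. by case: n / e. Qed.

Definition galg_of_sub : galg.
Proof.
refine (@GAlg (fun n => subm (S n)) sg_mul sg_one _ _ _ _ _).
- by move=> *; apply: subm_inj; rewrite subm_valP !mksubE subm_valP gmulPl.
- by move=> *; apply: subm_inj; rewrite subm_valP !mksubE subm_valP gmulPr.
- by move=> *; apply: subm_inj; rewrite val_gcast /= gmulA.
- by move=> *; apply: subm_inj; rewrite /= gmul1l.
- by move=> *; apply: subm_inj; rewrite val_gcast /= gmul1r.
Defined.
End SubGAlgebra.

(* The Leibniz rule carries the sign of the right-hand factor: this is what  *)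
(* the coboundary and the cup product of Hochschild cochains satisfy with    *)
(* the sign conventions adopted below.                                       *)
Record dga := DGA {
  dga_alg :> galg;
  dgd : forall n, {linear gcomp dga_alg n -> gcomp dga_alg n.+1};
  dgdd : forall n (a : dga_alg n), dgd n.+1 (dgd n a) = 0;
  dgdM : forall m n (a : dga_alg m) (b : dga_alg n),
    dgd (m + n)%N (gmul a b) =
      gcast (addnS m n) (gmul a (dgd n b)) + (-1) ^+ n *: gmul (dgd m a) b
}.

Record sub_dga (A : dga) := SubDGA {
  sd :> sub_galg A;
  sdd : forall n (a : A n), sd n a -> sd n.+1 (dgd A n a)
}.

Section SubDGAlgebra.
Variables (A : dga) (S : sub_dga A).

Definition sd_d n (a : subm (S n)) : subm (S n.+1) := mksub (sdd (subm_in a)).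
Fact sd_d_linear n : linear (@sd_d n).
Proof. by move=> c a b; apply: subm_inj; rewrite subm_valP !mksubE subm_valP linearP. Qed.
HB.instance Definition _ n :=
  GRing.isLinear.Build k (subm (S n)) (subm (S n.+1)) _ (@sd_d n) (@sd_d_linear n).

Definition dga_of_sub : dga.
Proof.
refine (@DGA (galg_of_sub S) (fun n => @sd_d n : {linear _ -> _}) _ _).
- by move=> n a; apply: subm_inj; rewrite /= dgdd.
- move=> m n a b; apply: subm_inj; rewrite subm_valD subm_valZ val_gcast.
  exact: dgdM.
Defined.
End SubDGAlgebra.

Section Cohomology.
Variable A : dga.

Definition is_cocycle n (a : A n) : Prop := dgd A n a = 0.
Definition is_coboundary n : A n -> Prop :=
  match n with
  | 0%N => fun a => a = 0
  | n'.+1 => fun a => exists b : A n', a = dgd A n' b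
  end.

Fact cocycle0 n : is_cocycle (0 : A n).
Proof. exact: linear0. Qed.
Fact cocycleP n c (a b : A n) : is_cocycle a -> is_cocycle b -> is_cocycle (c *: a + b).
Proof. by rewrite /is_cocycle linearP => -> ->; rewrite scaler0 addr0. Qed.
Fact coboundary0 n : is_coboundary (0 : A n).
Proof. by case: n => [//|n]; exists 0; rewrite linear0. Qed.
Fact coboundaryP n c (a b : A n) :
  is_coboundary a -> is_coboundary b -> is_coboundary (c *: a + b).
Proof.
case: n a b => [|n] a b /=; first by move=> -> ->; rewrite scaler0 addr0.
by case=> a' -> [b' ->]; exists (c *: a' + b'); rewrite linearP.
Qed.

Definition cocycles n : submod (A n) := Submod (@cocycle0 n) (@cocycleP n).

Fact coboundaries_subproof n c (a b : subm (cocycles n)) :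
  is_coboundary (subm_val a) -> is_coboundary (subm_val b) -> is_coboundary (subm_val (c *: a + b)).
Proof. by move=> *; rewrite subm_valP; apply: coboundaryP. Qed.

Definition coboundaries n : submod (subm (cocycles n)) :=
  @Submod _ (subm (cocycles n)) (fun a => is_coboundary (subm_val a))
    (@coboundary0 n) (@coboundaries_subproof n).

Definition coh n : lmodType k := quotm (coboundaries n).

Lemma coboundary_gcast m n (e : m = n) (a : A m) :
  is_coboundary a -> is_coboundary (gcast e a).
Proof. by case: n / e. Qed.

Fact cocycleM m n (a : A m) (b : A n) :
  is_cocycle a -> is_cocycle b -> is_cocycle (gmul a b).
Proof. by rewrite /is_cocycle dgdM => -> ->; rewrite gmul0r gcast0 gmul0l scaler0 addr0. Qed.

Fact cocycle1 : is_cocycle (gone A).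
Proof.
rewrite /is_cocycle; have := dgdM (gone A) (gone A).
rewrite gmul1l scale1r (gcast_id (addnS 0 0)) gmul1l.
have := gmul1r (dgd A 0%N (gone A)); rewrite (gcast_id (addn0 1)) => ->.
by rewrite -[X in X = _ -> _]addr0 => /addrI.
Qed.

Lemma coboundaryMl m n (a : A m) (b : A n) :
  is_coboundary a -> is_cocycle b -> is_coboundary (gmul a b).
Proof.
case: m a => [|m] a /=; first by move=> -> _; rewrite gmul0l; apply: coboundary0.
case=> a' -> b0; have := dgdM a' b; rewrite b0 gmul0r gcast0 add0r => h.
rewrite -[gmul _ _]scale1r -(expr1n k n) -[1]mulr1 -mulrNN exprMn -scalerA -h.
by rewrite /=; exists ((-1) ^+ n *: gmul a' b); rewrite linearZ.
Qed.

Lemma coboundaryMr m n (a : A m) (b : A n) :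
  is_cocycle a -> is_coboundary b -> is_coboundary (gmul a b).
Proof.
case: n b => [|n] b /= a0; first by move=> ->; rewrite gmul0r; apply: coboundary0.
case=> b' ->; have := dgdM a b'; rewrite a0 gmul0l scaler0 addr0 => h.
rewrite -[gmul _ _](gcastK (addnS m n)) -h; apply: coboundary_gcast.
by exists (gmul a b').
Qed.

Definition mul_cocycles m n (a : subm (cocycles m)) (b : subm (cocycles n)) :
  subm (cocycles (m + n)%N) :=
  mksub (S := cocycles (m + n)%N) (cocycleM (subm_in a) (subm_in b)).

Definition hcls n (a : subm (cocycles n)) : coh n := cls (coboundaries n) a.

Definition hmul m n (x : coh m) (y : coh n) : coh (m + n)%N :=
  hcls (mul_cocycles (rep x) (rep y)).
Definition hone : coh 0%N := hcls (mksub (S := cocycles 0%N) cocycle1).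

Lemma hmulE m n (a : subm (cocycles m)) (b : subm (cocycles n)) :
  hmul (hcls a) (hcls b) = hcls (mul_cocycles a b).
Proof.
apply/clsP; set a' := rep _; set b' := rep _.
change (is_coboundary (subm_val (mul_cocycles a' b' - mul_cocycles a b))).
have ha : is_coboundary (subm_val (a' - a)) by apply: (rep_cls (coboundaries m) a).
have hb : is_coboundary (subm_val (b' - b)) by apply: (rep_cls (coboundaries n) b).
rewrite subm_valB !mksubE.
have {1}-> : subm_val a' = subm_val a + subm_val (a' - a).
  by rewrite subm_valB addrC subrK.
have {1}-> : subm_val b' = subm_val b + subm_val (b' - b).
  by rewrite subm_valB addrC subrK.
rewrite gmulDl gmulDr.
have subC (M : zmodType) (x y z : M) : x + y + z - x = y + z.
  by rewrite addrAC [x + y]addrC addrK.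
rewrite subC -[gmul (subm_val a) _]scale1r.
apply: coboundaryP; first by apply: coboundaryMr (subm_in a) hb.
apply: coboundaryMl ha _; rewrite subm_valB addrC subrK; exact: (subm_in b').
Qed.

Lemma hcls_ind n (P : coh n -> Prop) : (forall a, P (hcls a)) -> forall x, P x.
Proof. by move=> h x; rewrite -[x](repK (S := coboundaries n)); apply: h. Qed.

Lemma hclsP_lin n c (a b : subm (cocycles n)) :
  hcls (c *: a + b) = c *: hcls a + hcls b.
Proof. exact: cls_is_linear. Qed.

Lemma gcast_hcls m n (e : m = n) (a : subm (cocycles m)) :
  gcast (A := coh) e (hcls a) = hcls (gcast (A := fun i => subm (cocycles i)) e a).
Proof. by case: n / e. Qed.

Lemma val_gcast_coc m n (e : m = n) (a : subm (cocycles m)) :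
  subm_val (gcast (A := fun i => subm (cocycles i)) e a) = gcast e (subm_val a).
Proof. by case: n / e. Qed.

Definition cohomology : galg.
Proof.
refine (@GAlg coh hmul hone _ _ _ _ _).
- move=> m n c; elim/hcls_ind=> a; elim/hcls_ind=> b; elim/hcls_ind=> x.
  rewrite -hclsP_lin !hmulE -hclsP_lin; congr hcls; apply: subm_inj.
  by rewrite subm_valP !mksubE subm_valP gmulPl.
- move=> m n c; elim/hcls_ind=> x; elim/hcls_ind=> a; elim/hcls_ind=> b.
  rewrite -hclsP_lin !hmulE -hclsP_lin; congr hcls; apply: subm_inj.
  by rewrite subm_valP !mksubE subm_valP gmulPr.
- move=> m n p; elim/hcls_ind=> a; elim/hcls_ind=> b; elim/hcls_ind=> c.
  rewrite !hmulE gcast_hcls; congr hcls; apply: subm_inj.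
  by rewrite val_gcast_coc /= gmulA.
- move=> n; elim/hcls_ind=> a; rewrite hmulE; congr hcls; apply: subm_inj.
  by rewrite /= gmul1l.
- move=> n; elim/hcls_ind=> a; rewrite hmulE gcast_hcls; congr hcls.
  by apply: subm_inj; rewrite val_gcast_coc /= gmul1r.
Defined.
End Cohomology.
End GradedAlgebras.

Section Invariants.
Variables (k : fieldType) (G : groupType).

Record action (V : lmodType k) := Action {
  act :> G -> {linear V -> V};
  act1 : forall v, act 1%g v = v;
  actM : forall t s v, act (t * s)%g v = act t (act s v)
}.

Section InvSubmod.
Variables (V : lmodType k) (r : action V).
Definition is_invariant (v : V) : Prop := forall s, r s v = v.
Fact invariant0 : is_invariant 0.
Proof. by move=> s; apply: linear0. Qed.
Fact invariantP a u v : is_invariant u -> is_invariant v -> is_invariant (a *: u + v).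
Proof. by move=> hu hv s; rewrite linearP hu hv. Qed.
Definition invariants : submod V := Submod invariant0 invariantP.
End InvSubmod.

Record kGmod := KGMod { kG_sort :> lmodType k; kG_act : action kG_sort }.

Record kGhom (M N : kGmod) := KGHom {
  kG_fun :> {linear M -> N};
  kG_equiv : forall s v, kG_fun (kG_act M s v) = kG_act N s (kG_fun v)
}.

Definition short_exact (U V W : lmodType k) (f : U -> V) (g : V -> W) : Prop :=
  [/\ injective f,
      forall v, g v = 0 <-> exists u, v = f u &
      forall w, exists v, g v = w].

Section InvFunctor.
Variables (M N : kGmod) (f : kGhom M N).
Fact inv_map_subproof (v : subm (invariants (kG_act M))) :
  invariants (kG_act N) (f (subm_val v)).
Proof. by move=> s; rewrite -kG_equiv (subm_in v s). Qed.
Definition inv_map (v : subm (invariants (kG_act M))) : subm (invariants (kG_act N)) :=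
  mksub (inv_map_subproof v).
End InvFunctor.

Definition invariants_exact : Prop :=
  forall (M N P : kGmod) (f : kGhom M N) (g : kGhom N P),
    short_exact f g -> short_exact (inv_map f) (inv_map g).

Record galg_action (A : galg k) := GAlgAction {
  ga_act :> forall n, action (gcomp A n);
  ga_act1 : forall s, ga_act 0%N s (gone A) = gone A;
  ga_actM : forall s m n (a : A m) (b : A n),
    ga_act (m + n)%N s (gmul a b) = gmul (ga_act m s a) (ga_act n s b)
}.

Record dga_action (A : dga k) := DGAAction {
  da_act :> galg_action A;
  da_actd : forall s n (a : A n), da_act n.+1 s (dgd A n a) = dgd A n (da_act n s a)
}.

Section InvSub.
Variables (A : galg k) (r : galg_action A).
Fact inv_galg_one : invariants (r 0%N) (gone A).
Proof. by move=> s; apply: ga_act1. Qed.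
Fact inv_galg_mul m n (a : A m) (b : A n) :
  invariants (r m) a -> invariants (r n) b -> invariants (r (m + n)%N) (gmul a b).
Proof. by move=> ha hb s; rewrite ga_actM ha hb. Qed.
Definition inv_sub_galg : sub_galg A :=
  @SubGAlg k A (fun n => invariants (r n)) inv_galg_one inv_galg_mul.
Definition inv_galg : galg k := galg_of_sub inv_sub_galg.
End InvSub.

Section InvDGA.
Variables (A : dga k) (r : dga_action A).
Fact inv_dga_d n (a : A n) : inv_sub_galg r n a -> inv_sub_galg r n.+1 (dgd A n a).
Proof. by move=> ha s; rewrite da_actd ha. Qed.
Definition inv_dga : dga k := dga_of_sub (SubDGA inv_dga_d).

Fact cocycle_act s n (a : A n) : cocycles A n a -> cocycles A n (r n s a).
Proof. by move=> ha; rewrite /= /is_cocycle -da_actd ha linear0. Qed.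

Definition act_cocycle s n (a : subm (cocycles A n)) : subm (cocycles A n) :=
  mksub (cocycle_act s (subm_in a)).

Definition coh_act_fun n s (x : coh A n) : coh A n := hcls (act_cocycle s (rep x)).

Lemma coboundary_act s n (a : A n) : is_coboundary a -> is_coboundary (r n s a).
Proof.
case: n a => [|n] a /=; first by move=> ->; rewrite linear0.
by case=> b ->; exists (r n s b); rewrite da_actd.
Qed.

Lemma coh_act_funE n s (a : subm (cocycles A n)) :
  coh_act_fun s (hcls a) = hcls (act_cocycle s a).
Proof.
apply/clsP; set a' := rep _.
change (is_coboundary (subm_val (act_cocycle s a' - act_cocycle s a))).
rewrite subm_valB !mksubE -linearB -subm_valB; apply: coboundary_act.
exact: (rep_cls (coboundaries A n) a).
Qed.

Fact coh_act_linear n s : linear (@coh_act_fun n s).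
Proof.
move=> c; elim/hcls_ind=> a; elim/hcls_ind=> b.
rewrite -hclsP_lin !coh_act_funE -hclsP_lin; congr hcls; apply: subm_inj.
by rewrite subm_valP !mksubE subm_valP linearP.
Qed.
HB.instance Definition _ n s :=
  GRing.isLinear.Build k (coh A n) (coh A n) _ (@coh_act_fun n s) (@coh_act_linear n s).

Definition coh_act n : action (coh A n).
Proof.
refine (@Action _ (fun s => @coh_act_fun n s : {linear _ -> _}) _ _).
- elim/hcls_ind=> a; rewrite /= coh_act_funE; congr hcls; apply: subm_inj.
  by rewrite mksubE act1.
- move=> t s; elim/hcls_ind=> a; rewrite /= !coh_act_funE; congr hcls.
  by apply: subm_inj; rewrite !mksubE actM.
Defined.

Definition coh_action : galg_action (cohomology A).
Proof.
refine (@GAlgAction (cohomology A) coh_act _ _).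
- move=> s; rewrite /= /hone coh_act_funE; congr hcls; apply: subm_inj.
  by rewrite !mksubE ga_act1.
- move=> s m n; elim/hcls_ind=> a; elim/hcls_ind=> b.
  rewrite /= hmulE !coh_act_funE hmulE; congr hcls; apply: subm_inj.
  by rewrite !mksubE ga_actM.
Defined.
End InvDGA.
End Invariants.

(* [hom y x] is the space of morphisms from x to y. *)
Record kcat (k : fieldType) := KCat {
  obj :> Type;
  hom : obj -> obj -> lmodType k;
  comp : forall z y x : obj, hom z y -> hom y x -> hom z x;
  idm : forall x : obj, hom x x;
  compPl : forall (z y x : obj) c (f g : hom z y) (h : hom y x),
    comp (c *: f + g) h = c *: comp f h + comp g h;
  compPr : forall (z y x : obj) c (h : hom z y) (f g : hom y x),
    comp h (c *: f + g) = c *: comp h f + comp h g;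
  compA : forall (w z y x : obj) (f : hom w z) (g : hom z y) (h : hom y x),
    comp f (comp g h) = comp (comp f g) h;
  comp1m : forall (y x : obj) (f : hom y x), comp (idm y) f = f;
  compm1 : forall (y x : obj) (f : hom y x), comp f (idm x) = f
}.

Section KCatTheory.
Variables (k : fieldType) (C : kcat k).

Lemma compDl (z y x : C) (f g : hom z y) (h : hom y x) :
  comp (f + g) h = comp f h + comp g h.
Proof. by rewrite -[f]scale1r compPl !scale1r. Qed.
Lemma comp0m (z y x : C) (h : hom y x) : comp (0 : hom z y) h = 0.
Proof. by apply: (addIr (comp 0 h)); rewrite -compDl addr0 add0r. Qed.
Lemma compZl (z y x : C) c (f : hom z y) (h : hom y x) :
  comp (c *: f) h = c *: comp f h.
Proof. by rewrite -[c *: f]addr0 compPl comp0m addr0. Qed.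
Lemma compDr (z y x : C) (h : hom z y) (f g : hom y x) :
  comp h (f + g) = comp h f + comp h g.
Proof. by rewrite -[f]scale1r compPr !scale1r. Qed.
Lemma compm0 (z y x : C) (h : hom z y) : comp h (0 : hom y x) = 0.
Proof. by apply: (addIr (comp h 0)); rewrite -compDr addr0 add0r. Qed.
Lemma compZr (z y x : C) c (h : hom z y) (f : hom y x) :
  comp h (c *: f) = c *: comp h f.
Proof. by rewrite -[c *: f]addr0 compPr compm0 addr0. Qed.

Definition hcast (y y' x x' : C) (ey : y = y') (ex : x = x') (f : hom y x) : hom y' x' :=
  match ey in _ = v, ex in _ = u return hom v u with erefl, erefl => f end.

(* [chain n z x] is the type of sequences (f_n, ..., f_1) of n composable    *)
(* morphisms from x to z: the disjoint union, over the intermediate objects, *)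
(* of the products of the corresponding morphism spaces.  There is an empty  *)
(* sequence from x to z exactly when z = x.                                  *)
Fixpoint chain (n : nat) (z x : C) : Type :=
  match n with
  | 0%N => z = x
  | n'.+1 => {y : C & (hom z y * chain n' y x)%type}
  end.

Definition ccons n (z y x : C) (f : hom z y) (p : chain n y x) : chain n.+1 z x :=
  existT _ y (f, p).

Lemma chain_case n (z x : C) (P : chain n.+1 z x -> Prop) :
  (forall (y : C) (f : hom z y) (p : chain n y x), P (ccons f p)) -> forall c, P c.
Proof. by move=> h [y [f p]]; apply: h. Qed.

(* The linear maps out of the tensor product of the morphism spaces are      *)
(* represented by the multilinear maps.                                      *)
Fixpoint multilinear (n : nat) (z x : C) (M : lmodType k) :
    (chain n z x -> M) -> Prop :=
  match n return (chain n z x -> M) -> Prop with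
  | 0%N => fun _ => True
  | n'.+1 => fun phi =>
      (forall (y : C) (p : chain n' y x), linear (fun f : hom z y => phi (ccons f p))) /\
      (forall (y : C) (f : hom z y), multilinear (fun p : chain n' y x => phi (ccons f p)))
  end.

Definition precochain n : lmodType k :=
  dprod (fun z : C => dprod (fun x : C => dprod (fun _ : chain n z x => hom z x))).

Definition is_cochain n (phi : precochain n) : Prop :=
  forall z x : C, multilinear (phi z x).

Lemma multilinear0 n (z x : C) (M : lmodType k) :
  multilinear (fun _ : chain n z x => 0 : M).
Proof.
elim: n z => [//|n IH] z; split=> [y p|y f]; last exact: IH.
by move=> c u v; rewrite scaler0 addr0.
Qed.

Lemma multilinearP n (z x : C) (M : lmodType k) a (phi psi : chain n z x -> M) :
  multilinear phi -> multilinear psi -> multilinear (fun c => a *: phi c + psi c).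
Proof.
elim: n z phi psi => [//|n IH] z phi psi [h1 h2] [h3 h4]; split=> [y p|y f].
  move=> c u v; rewrite h1 h3 !scalerDr !scalerA [a * c]mulrC -!addrA.
  by congr (_ + _); rewrite addrCA.
exact: (IH _ (fun p => phi (ccons f p)) (fun p => psi (ccons f p)) (h2 y f) (h4 y f)).
Qed.

Lemma eq_multilinear n (z x : C) (M : lmodType k) (phi psi : chain n z x -> M) :
  phi =1 psi -> multilinear phi -> multilinear psi.
Proof.
elim: n z phi psi => [//|n IH] z phi psi e [h1 h2]; split=> [y p|y f].
  by move=> c u v; rewrite -!e h1.
by apply: IH (h2 y f) => p; apply: e.
Qed.

Lemma multilinear_lin n (z x : C) (M N : lmodType k) (phi : chain n z x -> M)
    (F : M -> N) : linear F -> multilinear phi -> multilinear (F \o phi).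
Proof.
move=> lF; elim: n z phi => [//|n IH] z phi [h1 h2]; split=> [y p|y f].
  by move=> c u v /=; rewrite h1 lF.
exact: IH (h2 y f).
Qed.

Definition cochain_submod n : submod (precochain n) :=
  @Submod _ (precochain n) (@is_cochain n)
    (fun z x => @multilinear0 n z x (hom z x))
    (fun a u v hu hv z x => multilinearP a (hu z x) (hv z x)).

(* C^n: in degree 0 this is the product of the spaces [hom x x]. *)
Definition cochain n : lmodType k := subm (cochain_submod n).

Definition cval n (phi : cochain n) : forall z x : C, chain n z x -> hom z x :=
  subm_val phi.

Lemma cochain_inj n (phi psi : cochain n) :
  (forall (z x : C) (c : chain n z x), cval phi c = cval psi c) -> phi = psi.
Proof.
move=> h; apply: subm_inj; apply: functional_extensionality_dep => z.
apply: functional_extensionality_dep => x.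
by apply: functional_extensionality_dep => c; apply: h.
Qed.

Lemma cvalP n a (phi psi : cochain n) (z x : C) (c : chain n z x) :
  cval (a *: phi + psi) c = a *: cval phi c + cval psi c.
Proof. by rewrite /cval subm_valP. Qed.
Lemma cvalD n (phi psi : cochain n) (z x : C) (c : chain n z x) :
  cval (phi + psi) c = cval phi c + cval psi c.
Proof. by rewrite /cval subm_valD. Qed.
Lemma cvalZ n a (phi : cochain n) (z x : C) (c : chain n z x) :
  cval (a *: phi) c = a *: cval phi c.
Proof. by rewrite /cval subm_valZ. Qed.
Lemma cval0 n (z x : C) (c : chain n z x) : cval (0 : cochain n) c = 0.
Proof. by rewrite -(scale0r (0 : cochain n)) cvalZ scale0r. Qed.

(* For 1 <= i <= n+1, [face i] sends (f_(n+2), ..., f_1) to                  *)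
(* (f_(n+2), ..., f_(i+1) f_i, ..., f_1).                                    *)
Fixpoint face (n i : nat) (z x : C) : chain n.+2 z x -> chain n.+1 z x :=
  match n return chain n.+2 z x -> chain n.+1 z x with
  | 0%N => fun c =>
      let: existT y (f, existT w (g, q)) := c in ccons (n := 0) (comp f g) q
  | n'.+1 => fun c =>
      let: existT y (f, existT w (g, q)) := c in
      if i == n'.+2 then ccons (n := n'.+1) (comp f g) q
      else ccons f (@face n' i y x (ccons (n := n'.+1) g q))
  end.

(* (f_(n+1), ..., f_1) as the pair ((f_(n+1), ..., f_2), f_1). *)
Fixpoint unsnoc (n : nat) (z x : C) :
    chain n.+1 z x -> {w : C & (chain n z w * hom w x)%type} :=
  match n return chain n.+1 z x -> {w : C & (chain n z w * hom w x)%type} with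
  | 0%N => fun c =>
      let: existT y (f, e) := c in existT _ z (erefl z, hcast erefl e f)
  | n'.+1 => fun c =>
      let: existT y (f, p) := c in
      let: existT w (q, g) := unsnoc p in existT _ w (ccons f q, g)
  end.

Definition cfun n := forall z x : C, chain n z x -> hom z x.

(* The summands of the coboundary (d phi)(f_(n+1), ..., f_1): the product of *)
(* f_(n+1) with phi(f_n, ..., f_1), without its sign; the product of         *)
(* phi(f_(n+1), ..., f_2) with f_1; the signed sum over 1 <= i <= n of the   *)
(* terms involving f_(i+1) f_i, which is empty for n = 0.                    *)
Definition head_term n (phi : cfun n) (z x : C) (c : chain n.+1 z x) : hom z x :=
  let: existT y (f, p) := c in comp f (phi y x p).

Definition last_term n (phi : cfun n) (z x : C) (c : chain n.+1 z x) : hom z x :=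
  let: existT w (q, f) := unsnoc c in comp (phi z w q) f.

Definition inner_terms n : cfun n -> cfun n.+1 :=
  match n return cfun n -> cfun n.+1 with
  | 0%N => fun phi z x c => 0
  | n'.+1 => fun phi z x c =>
      \sum_(1 <= i < n'.+2) (-1) ^+ i *: phi z x (face i c)
  end.

Definition cobd_fun n (phi : cfun n) : cfun n.+1 := fun z x c =>
  (-1) ^+ n.+1 *: head_term phi c + inner_terms phi c + last_term phi c.

(* A recursive form of the inner and last terms, for cochains with values in *)
(* the morphisms to a fixed object z, starting at y.                         *)
Definition kfun (z y : C) n := forall x : C, chain n y x -> hom z x.

Definition kcons n (z y w : C) (psi : kfun z y n.+1) (f : hom y w) : kfun z w n :=
  fun x p => psi x (ccons f p).

Definition rmod n (z y w : C) : kfun z y n -> hom y w -> kfun z w n :=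
  match n return kfun z y n -> hom y w -> kfun z w n with
  | 0%N => fun psi f x e => comp (psi y erefl) (hcast erefl e f)
  | n'.+1 => fun psi f x c =>
      let: existT u (g, q) := c in psi x (ccons (comp f g) q)
  end.

Fixpoint dk n (z y : C) : kfun z y n -> kfun z y n.+1 :=
  match n return kfun z y n -> kfun z y n.+1 with
  | 0%N => fun psi x c => let: existT w (f, e) := c in rmod psi f e
  | n'.+1 => fun psi x c => let: existT w (f, p) := c in
      (-1) ^+ n'.+1 *: rmod psi f p + dk (kcons psi f) p
  end.

Lemma face_last n (z y w x : C) (f : hom z y) (g : hom y w) (q : chain n w x) :
  face n.+1 (ccons f (ccons g q)) = ccons (comp f g) q.
Proof. by case: n q => [|n] q //=; rewrite eqxx. Qed.

Lemma face_lt n i (z y w x : C) (f : hom z y) (g : hom y w) (q : chain n.+1 w x) :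
  (i < n.+2)%N -> face i (ccons f (ccons g q)) = ccons f (face i (ccons g q)).
Proof. by move=> lti; rewrite /= ltn_eqF. Qed.

Definition kinner (z y : C) n : kfun z y n -> kfun z y n.+1 :=
  match n return kfun z y n -> kfun z y n.+1 with
  | 0%N => fun phi x c => 0
  | n'.+1 => fun phi x c =>
      \sum_(1 <= i < n'.+2) (-1) ^+ i *: phi x (face i c)
  end.
Definition klast (z y : C) n (psi : kfun z y n) (x : C) (c : chain n.+1 y x) : hom z x :=
  let: existT w (q, f) := unsnoc c in comp (psi w q) f.

Lemma dkE n (z y x : C) (psi : kfun z y n) (c : chain n.+1 y x) :
  dk psi c = kinner psi c + klast psi c.
Proof.
elim: n y psi c => [|n IH] y psi; elim/chain_case=> w f p.
  by rewrite /klast /kinner /= add0r; case: x / p.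
rewrite [dk _ _]/= IH; case: p => v [g q].
have -> : klast psi (ccons f (ccons g q)) = klast (kcons psi f) (ccons g q).
  rewrite {1}/klast [unsnoc _]/= -/(unsnoc (ccons g q)).
  by rewrite /klast; case: (unsnoc (ccons g q)) => u [r h].
rewrite [kinner psi _]/= big_nat_recr //= -/(face n.+1 _) (face_last f g q).
rewrite [X in _ = X + _]addrC addrA; congr (_ + _ + _).
case: n q psi {IH} => [|n] q psi; first by rewrite big_geq.
rewrite [kinner _ _]/= !big_nat; apply: eq_bigr => i /andP[_ lti].
by rewrite (face_lt f g q).
Qed.

Lemma cobdE n (phi : cfun n) (z y x : C) (f : hom z y) (p : chain n y x) :
  cobd_fun phi (ccons f p) =
    (-1) ^+ n.+1 *: comp f (phi y x p) + dk (phi z) (ccons f p).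
Proof. by rewrite dkE addrA; case: n phi p. Qed.

Lemma dk_cons n (z y w x : C) (psi : kfun z y n.+1) (f : hom y w) (p : chain n.+1 w x) :
  dk psi (ccons f p) = (-1) ^+ n.+1 *: rmod psi f p + dk (kcons psi f) p.
Proof. by []. Qed.

Lemma eq_rmod n (z y w x : C) (f g : kfun z y n) (u : hom y w) (c : chain n w x) :
  (forall x (c : chain n y x), f x c = g x c) -> rmod f u c = rmod g u c.
Proof. by case: n f g c => [|n] f g c e /=; [rewrite e | case: c => v [h q]]. Qed.

Lemma eq_dk n (z y x : C) (f g : kfun z y n) (c : chain n.+1 y x) :
  (forall x (c : chain n y x), f x c = g x c) -> dk f c = dk g c.
Proof.
elim: n y f g c => [|n IH] y f g [w [u p]] e; first exact: eq_rmod.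
rewrite !dk_cons (eq_rmod _ _ e); congr (_ + _).
by apply: IH => x' c; apply: e.
Qed.

Lemma rmodP n (z y w x : C) a (f g : kfun z y n) (u : hom y w) (c : chain n w x) :
  rmod (fun x c => a *: f x c + g x c) u c = a *: rmod f u c + rmod g u c.
Proof. by case: n f g c => [|n] f g c /=; [rewrite compPl | case: c => v [h q]]. Qed.

Lemma dkP n (z y x : C) a (f g : kfun z y n) (c : chain n.+1 y x) :
  dk (fun x c => a *: f x c + g x c) c = a *: dk f c + dk g c.
Proof.
elim: n y f g c => [|n IH] y f g [w [u p]]; first exact: rmodP.
rewrite !dk_cons rmodP (IH _ (kcons f u) (kcons g u)) !scalerDr !scalerA [_ * a]mulrC -!addrA.
by congr (_ + _); rewrite addrCA.
Qed.

Lemma rmod_comp n (z y w v x : C) (psi : kfun z y n) (f : hom y w) (g : hom w v)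
  (c : chain n v x) : rmod (rmod psi f) g c = rmod psi (comp f g) c.
Proof.
case: n psi c => [|n] psi c /=; last by case: c => u [h q] /=; rewrite compA.
by case: x / c => /=; rewrite compA.
Qed.

Lemma hcast_comp (z y x x' : C) (e : x = x') (f : hom z y) (g : hom y x) :
  hcast erefl e (comp f g) = comp f (hcast erefl e g).
Proof. by case: x' / e. Qed.

Lemma dk_rmod n (z y w x : C) (psi : kfun z y n) (f : hom y w) (c : chain n.+1 w x) :
  dk (rmod psi f) c = rmod (dk psi) f c.
Proof.
case: n psi c => [|n] psi; elim/chain_case=> v g q.
  exact: (rmod_comp psi f g q).
rewrite -[RHS]/(dk psi (ccons (comp f g) q)) !dk_cons.
by rewrite (rmod_comp psi f g q).
Qed.

Lemma dk_dk n (z y x : C) (psi : kfun z y n) (c : chain n.+2 y x) : dk (dk psi) c = 0.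
Proof.
elim: n y psi c => [|n IH] y psi; elim/chain_case=> w f p.
  rewrite dk_cons expr1 scaleN1r -dk_rmod.
  by rewrite (@eq_dk _ _ _ _ (kcons (dk psi) f) (rmod psi f)) ?addNr.
rewrite dk_cons -dk_rmod.
rewrite (@eq_dk _ _ _ _ (kcons (dk psi) f)
   (fun x c => (-1) ^+ n.+1 *: rmod psi f c + dk (kcons psi f) c)) //.
by rewrite dkP IH addr0 [in X in X + _]exprS mulN1r scaleNr addNr.
Qed.

Lemma dk_comp n (z y v x : C) (u : hom z v) (psi : kfun v y n) (c : chain n.+1 y x) :
  dk (fun x c => comp u (psi x c)) c = comp u (dk psi c).
Proof.
elim: n y psi c => [|n IH] y psi; elim/chain_case=> w f p.
  by rewrite /= compA.
rewrite /= compDr compZr -IH; congr (_ *: _ + _).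
by case: p => t [g q].
Qed.

Lemma cobd_cobd n (phi : cfun n) (z x : C) (c : chain n.+2 z x) :
  cobd_fun (cobd_fun phi) c = 0.
Proof.
elim/chain_case: c => y f p; rewrite cobdE.
rewrite (@eq_dk _ _ _ _ (@cobd_fun n phi z)
  (fun x c => (-1) ^+ n.+1 *: head_term phi c + dk (phi z) c)); last first.
  by move=> x'; elim/chain_case=> w g q; rewrite cobdE.
rewrite dkP dk_dk addr0 dk_cons.
rewrite (@eq_dk _ _ _ _ (kcons (@head_term n phi z) f) (fun x c => comp f (phi y x c))) //.
rewrite dk_comp; elim/chain_case: p => w g q.
rewrite cobdE -[rmod _ _ _]/(comp (comp f g) (phi w x q)).
by rewrite [(-1) ^+ n.+2]exprS mulN1r scaleNr compDr compZr compA addNr.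
Qed.

Lemma rmod_lin n (z y w x : C) (psi : kfun z y n) (c : chain n w x) :
  multilinear (psi x) -> linear (fun f : hom y w => rmod psi f c).
Proof.
case: n psi c => [|n] psi c; first by move=> _ a f g /=; case: x / c; rewrite compPr.
by case: c => v [g q] [h1 h2] a u u' /=; rewrite compPl h1.
Qed.

Lemma rmod_multi n (z y w x : C) (psi : kfun z y n) (f : hom y w) :
  multilinear (psi x) -> multilinear (@rmod n z y w psi f x).
Proof.
case: n psi => [//|n] psi [h1 h2]; split=> [v p|v g]; last exact: h2.
by move=> a u u' /=; rewrite compPr h1.
Qed.

Lemma dk_multi n (z y : C) (psi : kfun z y n) :
  (forall x, multilinear (psi x)) -> forall x, multilinear (@dk n z y psi x).
Proof.
elim: n y psi => [|n IH] y psi h x.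
  split=> // v p; exact: (rmod_lin (psi := psi) p (h x)).
split=> [v p|v f]; last first.
  apply: (@multilinearP n.+1 v x _ ((-1) ^+ n.+1) (@rmod _ _ _ _ psi f x) (@dk _ _ _ (kcons psi f) x)).
    exact: rmod_multi.
  by apply: IH => x'; have [_ h2] := h x'; apply: h2.
move=> a f g; rewrite !dk_cons (rmod_lin _ (h x)).
have -> : dk (kcons psi (a *: f + g)) p = a *: dk (kcons psi f) p + dk (kcons psi g) p.
  rewrite -dkP; apply: eq_dk => x' c.
  by have [h1 _] := h x'; rewrite /kcons h1.
rewrite !scalerDr !scalerA [a * _]mulrC -!addrA.
by congr (_ + _); rewrite addrCA.
Qed.

Lemma head_multi n (phi : cfun n) (z x : C) :
  (forall z x, multilinear (phi z x)) -> multilinear (@head_term n phi z x).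
Proof.
move=> h; split=> [y p|y f]; first by move=> a f g; apply: compPl.
exact: (@multilinear_lin _ _ _ _ _ (phi y x) (comp f) (fun a u v => compPr a f u v) (h y x)).
Qed.

Lemma cobd_multi n (phi : cfun n) :
  (forall z x, multilinear (phi z x)) -> forall z x, multilinear (@cobd_fun n phi z x).
Proof.
move=> h z x.
apply: (@eq_multilinear _ _ _ _
  (fun c => (-1) ^+ n.+1 *: head_term phi c + dk (phi z) c)).
  by elim/chain_case=> y f p; rewrite cobdE.
apply: multilinearP; first exact: head_multi.
exact: dk_multi.
Qed.

Definition cobd n (phi : cochain n) : cochain n.+1 :=
  mksub (S := cochain_submod n.+1) (cobd_multi (subm_in phi)).

Lemma cval_cobd n (phi : cochain n) (z x : C) (c : chain n.+1 z x) :
  cval (cobd phi) c = cobd_fun (cval phi) c.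
Proof. by []. Qed.

Fact cobd_linear n : linear (@cobd n).
Proof.
move=> a phi psi; apply: cochain_inj => z x; elim/chain_case=> y f p.
rewrite cvalP !cval_cobd !cobdE cvalP.
rewrite (@eq_dk _ _ _ _ (@cval _ (a *: phi + psi) z)
  (fun x c => a *: cval phi c + cval psi c)); last by move=> *; rewrite cvalP.
rewrite dkP compPr !scalerDr !scalerA [a * _]mulrC -!addrA.
by congr (_ + _); rewrite addrCA.
Qed.
HB.instance Definition _ n :=
  GRing.isLinear.Build k (cochain n) (cochain n.+1) _ (@cobd n) (@cobd_linear n).

Lemma cobdd n (phi : cochain n) : cobd (cobd phi) = 0.
Proof. by apply: cochain_inj => z x c; rewrite cval0; apply: cobd_cobd. Qed.

(* (f_(m+n), ..., f_1) as ((f_(m+n), ..., f_(n+1)), (f_n, ..., f_1)). *)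
Fixpoint split_chain (m n : nat) (z x : C) :
    chain (m + n)%N z x -> {y : C & (chain m z y * chain n y x)%type} :=
  match m return chain (m + n)%N z x -> {y : C & (chain m z y * chain n y x)%type} with
  | 0%N => fun c => existT _ z (erefl z, c)
  | m'.+1 => fun c =>
      let: existT y (f, p) := c in
      let: existT w (q, r) := @split_chain m' n y x p in existT _ w (ccons f q, r)
  end.

Definition cup_fun m n (psi : cfun m) (phi : cfun n) : cfun (m + n)%N := fun z x c =>
  let: existT y (q, r) := split_chain c in comp (psi z y q) (phi y x r).

Definition kcup m n (z y : C) (psi : kfun z y m) (phi : cfun n) : kfun z y (m + n)%N :=
  fun x c => let: existT w (q, r) := split_chain c in comp (psi w q) (phi w x r).

Lemma kcup0 n (z y x : C) (psi : kfun z y 0) (phi : cfun n) (c : chain (0 + n)%N y x) :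
  kcup psi phi c = comp (psi y erefl) (phi y x c).
Proof. by []. Qed.

Lemma kcupS m n (z y w x : C) (psi : kfun z y m.+1) (phi : cfun n) (f : hom y w)
    (p : chain (m + n)%N w x) :
  kcup (m := m.+1) psi phi (ccons f p) = kcup (kcons psi f) phi p.
Proof. by rewrite /kcup /=; case: (split_chain p) => v [q r]. Qed.

Lemma kcup_multi m n (z y : C) (psi : kfun z y m) (phi : cfun n) :
  (forall x, multilinear (psi x)) -> (forall z x, multilinear (phi z x)) ->
  forall x, multilinear (@kcup m n z y psi phi x).
Proof.
elim: m y psi => [|m IH] y psi h1 h2 x.
  exact: (@multilinear_lin _ _ _ _ _ (phi y x) (comp (psi y erefl)) (fun a u v => compPr a _ u v) (h2 y x)).
split=> [v p|v f]; last first.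
  apply: (@eq_multilinear _ _ _ _ (kcup (kcons psi f) phi (x := x))).
    by move=> p; rewrite kcupS.
  by apply: IH h2 _ => x'; have [_ h] := h1 x'; apply: h.
move=> a f g; rewrite !kcupS /kcup; case: (split_chain p) => w [q r].
by have [h _] := h1 w; rewrite /kcons h compPl.
Qed.

Definition cup m n (psi : cochain m) (phi : cochain n) : cochain (m + n)%N :=
  mksub (S := cochain_submod (m + n)%N) (v := cup_fun (cval psi) (cval phi))
    (fun z => kcup_multi (subm_in psi z) (subm_in phi)).

Lemma cval_cup m n (psi : cochain m) (phi : cochain n) (z x : C)
    (c : chain (m + n)%N z x) :
  cval (cup psi phi) c = kcup (@cval _ psi z) (cval phi) c.
Proof. by []. Qed.

Definition unit_fun : cfun 0 := fun z x e => hcast erefl e (idm z).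
Fact unit_multi (z x : C) : multilinear (@unit_fun z x).
Proof. by []. Qed.
Definition cunit : cochain 0 := mksub (S := cochain_submod 0) unit_multi.

Definition lcast m n (e : m = n) (z x : C) (c : chain m z x) : chain n z x :=
  match e in _ = p return chain p z x with erefl => c end.

Lemma cval_gcast m n (e : m = n) (phi : cochain m) (z x : C) (c : chain n z x) :
  cval (gcast (A := cochain) e phi) c = cval phi (lcast (esym e) c).
Proof. by case: n / e c. Qed.

Lemma lcast_cons m n (e : m.+1 = n.+1) (z y x : C) (f : hom z y) (p : chain m y x) :
  lcast e (ccons f p) = ccons f (lcast (succn_inj e) p).
Proof.
have e' := succn_inj e; case: n / e' e => e.
by rewrite (Prop_irrelevance e erefl) (Prop_irrelevance (succn_inj _) erefl).
Qed.

Lemma lcast_id m (e : m = m) (z x : C) (c : chain m z x) : lcast e c = c.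
Proof. by rewrite (Prop_irrelevance e erefl). Qed.

Lemma kcup_comp m n (z v y x : C) (u : hom z v) (psi : kfun v y m) (phi : cfun n)
    (c : chain (m + n)%N y x) :
  kcup (fun x q => comp u (psi x q)) phi c = comp u (kcup psi phi c).
Proof. by rewrite /kcup; case: (split_chain c) => w [q r]; rewrite compA. Qed.

Lemma kcupA m n p (z y x : C) (a : kfun z y m) (b : cfun n) (d : cfun p)
    (e : (m + n + p = m + (n + p))%N) (c : chain (m + n + p)%N y x) :
  kcup a (cup_fun b d) (lcast e c) = kcup (kcup a b) d c.
Proof.
elim: m y a e c => [|m IH] y a e c.
  rewrite lcast_id kcup0 -[cup_fun b d c]/(kcup (b y) d c).
  by rewrite -kcup_comp.
elim/chain_case: c => w f q; rewrite (lcast_cons e) kcupS IH.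
have E := @kcupS (m + n)%N p z y w x (kcup (m := m.+1) a b) d f q.
apply: etrans (esym E); rewrite /kcup; case: split_chain => u [r s].
by congr comp; rewrite -[RHS]/(kcup a b (ccons f r)) kcupS.
Qed.

Lemma kcup1 m (z y x : C) (a : kfun z y m) (e : m = (m + 0)%N) (c : chain m y x) :
  kcup a unit_fun (lcast e c) = a x c.
Proof.
elim: m y a e c => [|m IH] y a e c.
  by rewrite lcast_id kcup0 /unit_fun; case: x / c; rewrite compm1.
by elim/chain_case: c => w f q; rewrite (lcast_cons e) kcupS IH.
Qed.

Lemma rmod_kcup m n (z y w x : C) (psi : kfun z y m.+1) (phi : cfun n) (f : hom y w)
    (c : chain (m.+1 + n)%N w x) :
  rmod (kcup psi phi) f c = kcup (rmod psi f) phi c.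
Proof.
elim/chain_case: c => v g q; rewrite -[LHS]/(kcup psi phi (ccons (comp f g) q)) !kcupS.
by rewrite /kcup; case: (split_chain q) => u [r s].
Qed.

Lemma kcupDl m n (z y x : C) a (f g : kfun z y m) (phi : cfun n) (c : chain (m + n)%N y x) :
  kcup (fun x c => a *: f x c + g x c) phi c = a *: kcup f phi c + kcup g phi c.
Proof. by rewrite /kcup; case: (split_chain c) => w [q r]; rewrite compPl. Qed.

Lemma dk_kcup m n (z y x : C) (psi : kfun z y m) (phi : cfun n)
    (e : (m + n).+1 = (m + n.+1)%N) (c : chain (m + n).+1 y x) :
  dk (kcup psi phi) c =
    kcup psi (cobd_fun phi) (lcast e c) + (-1) ^+ n *: kcup (dk psi) phi c.
Proof.
elim: m y psi e c => [|m IH] y psi e; elim/chain_case=> w f p.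
  rewrite lcast_id kcup0 cobdE.
  rewrite (@eq_dk _ _ _ _ (kcup psi phi) (fun x c => comp (psi y erefl) (phi y x c))) //.
  rewrite dk_comp (@kcupS 0 n) kcup0 /kcons /= compDr compZr exprS mulN1r scaleNr.
  by rewrite compA addrAC addNr add0r.
have E1 := @kcupS m n.+1 z y w x psi (cobd_fun phi) f (lcast (succn_inj e) p).
rewrite (lcast_cons e) kcupS [X in _ = X + _]E1.
rewrite (@dk_cons (m + n)%N) rmod_kcup.
rewrite (@eq_dk _ _ _ _ (kcons (kcup psi phi) f) (kcup (kcons psi f) phi)); last first.
  by move=> x' c; rewrite -kcupS.
rewrite (IH w (kcons psi f) (succn_inj e)) addrCA; congr (_ + _).
transitivity ((-1) ^+ n *: kcup (fun x c => (-1) ^+ m.+1 *: rmod psi f c + dk (kcons psi f) c) phi p).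
  by rewrite kcupDl scalerDr scalerA -exprD [in (n + _)%N]addnC.
by congr (_ *: _).
Qed.

Lemma cobd_cup m n (psi : cochain m) (phi : cochain n) :
  cobd (cup psi phi) =
    gcast (A := cochain) (addnS m n) (cup psi (cobd phi)) + (-1) ^+ n *: cup (cobd psi) phi.
Proof.
apply: cochain_inj => z x; elim/chain_case=> y f p.
rewrite cval_cobd cobdE cvalD cvalZ cval_gcast !cval_cup.
rewrite (@eq_dk _ _ _ _ (@cval _ (cup psi phi) z) (kcup (@cval _ psi z) (cval phi))) //.
rewrite (@dk_kcup _ _ _ _ _ _ _ (esym (addnS m n))) addrCA; congr (_ + _).
rewrite !(@kcupS m n).
transitivity ((-1) ^+ n *: kcup (fun x c => (-1) ^+ m.+1 *: comp f (cval psi c) + dk (@cval _ psi z) (ccons f c)) (cval phi) p).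
  by rewrite kcupDl kcup_comp scalerDr scalerA -exprD addnS [(n + m)%N]addnC.
congr (_ *: _).
have E : cval (cup (cobd psi) phi) (ccons f p) =
    kcup (kcons (@cval _ (cobd psi) z) f) (cval phi) p by exact: (@kcupS m n).
apply: etrans (esym E); rewrite /kcup; case: (split_chain p) => w [q r].
by congr comp; rewrite -[RHS]/(cobd_fun (cval psi) (ccons f q)) cobdE.
Qed.

Definition hoch_galg : galg k.
Proof.
refine (@GAlg k cochain cup cunit _ _ _ _ _).
- move=> m n a f g h; apply: cochain_inj => z x c; rewrite cvalP !cval_cup -kcupDl.
  by rewrite /kcup; case: (split_chain c) => w [q r]; rewrite cvalP.
- move=> m n a h f g; apply: cochain_inj => z x c; rewrite cvalP !cval_cup.
  by rewrite /kcup; case: (split_chain c) => w [q r]; rewrite cvalP compPr.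
- move=> m n p a b c; apply: cochain_inj => z x d; rewrite cval_gcast !cval_cup.
  exact: kcupA.
- by move=> n a; apply: cochain_inj => z x c; rewrite cval_cup kcup0; apply: comp1m.
- move=> n a; apply: cochain_inj => z x c; rewrite cval_gcast cval_cup.
  exact: kcup1.
Defined.

Definition hoch_dga : dga k :=
  @DGA k hoch_galg (fun n => @cobd n : {linear _ -> _}) cobdd cobd_cup.

Definition HH : galg k := cohomology hoch_dga.
End KCatTheory.

(* V is the internal direct sum of the subspaces W s. *)
Definition direct_sum (k : fieldType) (I : eqType) (V : lmodType k)
    (W : I -> submod V) : Prop :=
  (forall v, exists (r : seq I) (w : I -> V),
      (forall s, W s (w s)) /\ v = \sum_(s <- r) w s) /\
  (forall (r : seq I) (w : I -> V), uniq r -> (forall s, W s (w s)) ->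
      \sum_(s <- r) w s = 0 -> forall s, s \in r -> w s = 0).

(* [gr s y x] is the space of morphisms of degree s from x to y. *)
Record grkcat (k : fieldType) (G : groupType) := GrKCat {
  gr_cat :> kcat k;
  gr : G -> forall y x : gr_cat, submod (hom y x);
  gr_sum : forall y x : gr_cat, direct_sum (fun s => gr s y x);
  gr_id : forall x : gr_cat, gr 1%g x x (idm x);
  gr_comp : forall (t s : G) (z y x : gr_cat) (g : hom z y) (f : hom y x),
    gr t z y g -> gr s y x f -> gr (t * s)%g z x (comp g f)
}.

Section TrivialClass.
Variables (k : fieldType) (G : groupType) (B : grkcat k G).

(* [homog s c]: the entries of c = (f_n, ..., f_1) are homogeneous, of       *)
(* degrees s_n, ..., s_1 with s = s_n ... s_1.                               *)
Fixpoint homog (s : G) (n : nat) (z x : B) : chain n z x -> Prop :=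
  match n return chain n z x -> Prop with
  | 0%N => fun _ => s = 1%g
  | n'.+1 => fun c => let: existT y (f, p) := c in
      exists t u : G, [/\ s = (t * u)%g, gr t z y f & homog u p]
  end.

Definition deg_preserving n (phi : cochain B n) : Prop :=
  forall (s : G) (z x : B) (c : chain n z x), homog s c -> gr s z x (cval phi c).

Fact deg_preserving0 n : deg_preserving (0 : cochain B n).
Proof. by move=> s z x c _; rewrite cval0; apply: submod0. Qed.
Fact deg_preservingP n a (phi psi : cochain B n) :
  deg_preserving phi -> deg_preserving psi -> deg_preserving (a *: phi + psi).
Proof. by move=> h1 h2 s z x c hc; rewrite cvalP; apply: submodP; auto. Qed.

Definition deg_submod n : submod (cochain B n) :=
  Submod (@deg_preserving0 n) (@deg_preservingP n).

Lemma homog_cons (s : G) n (z y x : B) (f : hom z y) (p : chain n y x) :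
  homog s (ccons f p) <-> exists t u : G, [/\ s = (t * u)%g, gr t z y f & homog u p].
Proof. by []. Qed.

Definition kdeg (t : G) n (z y : B) (psi : kfun z y n) : Prop :=
  forall (s : G) (x : B) (c : chain n y x), homog s c -> gr (t * s)%g z x (psi x c).

Lemma kdeg_cons t u n (z y w : B) (psi : kfun z y n.+1) (f : hom y w) :
  kdeg t psi -> gr u y w f -> kdeg (t * u)%g (kcons psi f).
Proof.
move=> hp hf s x c hc; rewrite -mulgA; apply: hp.
by apply/homog_cons; exists u, s.
Qed.

Lemma gr_hcast s (y x x' : B) (e : x = x') (f : hom y x) :
  gr s y x f -> gr s y x' (hcast erefl e f).
Proof. by case: x' / e. Qed.

Lemma kdeg_rmod t u n (z y w : B) (psi : kfun z y n) (f : hom y w) :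
  kdeg t psi -> gr u y w f -> kdeg (t * u)%g (@rmod _ _ n z y w psi f).
Proof.
case: n psi => [|n] psi hp hf s x c.
  move=> /= ->; rewrite mulg1; apply: gr_comp; last exact: gr_hcast.
  by rewrite -[t]mulg1; apply: hp.
elim/chain_case: c => v g q /homog_cons[a [b [-> hg hq]]].
rewrite -[rmod _ _ _]/(psi x (ccons (comp f g) q)).
rewrite -mulgA; apply: hp; apply/homog_cons; exists (u * a)%g, b.
by split=> //; [rewrite mulgA | apply: gr_comp].
Qed.

Lemma kdeg_dk t n (z y : B) (psi : kfun z y n) :
  kdeg t psi -> kdeg t (@dk _ _ n z y psi).
Proof.
elim: n y t psi => [|n IH] y t psi hp s x; elim/chain_case=> w f p.
  case/homog_cons=> a [b [-> hf hq]]; rewrite mulgA.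
  exact: (@kdeg_rmod t a 0 z y w psi f hp hf b x p hq).
case/homog_cons=> a [b [-> hf hq]]; rewrite dk_cons mulgA; apply: submodP.
  exact: (@kdeg_rmod t a n.+1 z y w psi f hp hf b x p hq).
exact: (IH w (t * a)%g (kcons psi f) (kdeg_cons hp hf) b x p hq).
Qed.

Fact deg_cobd n (phi : cochain B n) : deg_preserving phi -> deg_preserving (cobd phi).
Proof.
move=> hp s z x; elim/chain_case=> y f p hc; rewrite cval_cobd cobdE.
apply: submodP.
  by case/homog_cons: hc => t [u [-> hf hq]]; apply: gr_comp => //; apply: hp.
rewrite -[s]mul1g; apply: (@kdeg_dk 1%g) hc => u v c hu.
by rewrite mul1g; apply: hp.
Qed.

Lemma kdeg_cup t m n (z y : B) (psi : kfun z y m) (phi : cochain B n) :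
  kdeg t psi -> deg_preserving phi -> kdeg t (@kcup _ _ m n z y psi (cval phi)).
Proof.
move=> h1 h2; elim: m y t psi h1 => [|m IH] y t psi h1 s x c.
  move=> hc; rewrite kcup0; apply: gr_comp; last exact: h2.
  by rewrite -[t]mulg1; apply: h1.
elim/chain_case: c => w f q /homog_cons[a [b [-> hf hq]]].
rewrite (@kcupS _ _ m n) mulgA; apply: (IH w (t * a)%g) hq; exact: kdeg_cons.
Qed.

Fact deg_cup m n (psi : cochain B m) (phi : cochain B n) :
  deg_preserving psi -> deg_preserving phi -> deg_preserving (cup psi phi).
Proof.
move=> h1 h2 s z x c hc; rewrite cval_cup -[s]mul1g.
by apply: kdeg_cup hc => // u v d hu; rewrite mul1g; apply: h1.
Qed.

Fact deg_unit : deg_preserving (cunit B).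
Proof. by move=> s z x e /= ->; apply/gr_hcast/gr_id. Qed.

Definition deg_sub_galg : sub_galg (hoch_dga B) :=
  @SubGAlg k (hoch_dga B) deg_submod deg_unit deg_cup.

Definition hoch1_dga : dga k := dga_of_sub (@SubDGA k (hoch_dga B) deg_sub_galg deg_cobd).
Definition HH1 : galg k := cohomology hoch1_dga.
End TrivialClass.

Record gkcat (k : fieldType) (G : groupType) := GKCat {
  gk_cat :> kcat k;
  oact : G -> gk_cat -> gk_cat;
  mact : forall (s : G) (y x : gk_cat), {linear hom y x -> hom (oact s y) (oact s x)};
  oact1 : forall x, oact 1%g x = x;
  oactM : forall t s x, oact (t * s)%g x = oact t (oact s x);
  mact_id : forall s x, mact s x x (idm x) = idm (oact s x);
  mact_comp : forall s (z y x : gk_cat) (g : hom z y) (f : hom y x),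
    mact s z x (comp g f) = comp (mact s z y g) (mact s y x f);
  mact1 : forall (y x : gk_cat) (f : hom y x),
    hcast (oact1 y) (oact1 x) (mact 1%g y x f) = f;
  mactM : forall t s (y x : gk_cat) (f : hom y x),
    hcast (oactM t s y) (oactM t s x) (mact (t * s)%g y x f) =
      mact t (oact s y) (oact s x) (mact s y x f)
}.

Definition free_action (k : fieldType) (G : groupType) (C : gkcat k G) : Prop :=
  forall (s : G) (x : C), oact s x = x -> s = 1%g.

Section TotalMorphisms.
Variables (k : fieldType) (C : kcat k).

Definition tot (y x : C) (f : hom y x) : {yx : C * C & hom yx.1 yx.2} :=
  existT (fun yx : C * C => hom yx.1 yx.2) (y, x) f.

Lemma tot_hcast (y y' x x' : C) (ey : y = y') (ex : x = x') (f : hom y x) :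
  tot (hcast ey ex f) = tot f.
Proof. by case: y' / ey; case: x' / ex. Qed.

Lemma tot_inj (y x : C) (f g : hom y x) : tot f = tot g -> f = g.
Proof.
by move=> h; have := projT2_eq h; rewrite (Prop_irrelevance (projT1_eq h) erefl).
Qed.

Lemma totP (y x y' x' : C) (f : hom y x) (f' : hom y' x') : tot f = tot f' ->
  exists (ey : y = y') (ex : x = x'), f' = hcast ey ex f.
Proof.
move=> h.
have ey : y = y' := congr1 (fun u => (projT1 u).1) h.
have ex : x = x' := congr1 (fun u => (projT1 u).2) h.
exists ey, ex; apply: tot_inj; by rewrite tot_hcast.
Qed.

Lemma tot_comp (z y x z' y' x' : C) (f : hom z y) (g : hom y x)
    (f' : hom z' y') (g' : hom y' x') :
  tot f = tot f' -> tot g = tot g' -> tot (comp f g) = tot (comp f' g').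
Proof.
case/totP=> ez [ey ->]; case/totP=> ey' [ex ->].
case: z' / ez f'; case: x' / ex g' => _ _; move: ey'; case: y' / ey => ey'.
by rewrite (Prop_irrelevance ey' erefl).
Qed.

Definition ctot n (z x : C) (c : chain n z x) : {zx : C * C & chain n zx.1 zx.2} :=
  existT (fun zx : C * C => chain n zx.1 zx.2) (z, x) c.

Lemma ctot_cons n (z y x z' y' x' : C) (f : hom z y) (p : chain n y x)
    (f' : hom z' y') (p' : chain n y' x') :
  tot f = tot f' -> ctot p = ctot p' -> ctot (ccons f p) = ctot (ccons f' p').
Proof.
case/totP=> ez [ey ->] h.
have ex : x = x' := congr1 (fun u => (projT1 u).2) h.
case: z' / ez f'; case: x' / ex p' h; case: y' / ey => p' h _.
have := projT2_eq h; rewrite (Prop_irrelevance (projT1_eq h) erefl).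
by move=> /= ->.
Qed.

Lemma ctot_ind n (P : forall z x : C, chain n z x -> Prop)
    (z x z' x' : C) (c : chain n z x) (c' : chain n z' x') :
  ctot c = ctot c' -> P z x c -> P z' x' c'.
Proof.
move=> h; change (P (projT1 (ctot c)).1 (projT1 (ctot c)).2 (projT2 (ctot c)) ->
  P (projT1 (ctot c')).1 (projT1 (ctot c')).2 (projT2 (ctot c'))).
by rewrite h.
Qed.

Lemma tot_cfun n (phi : cfun C n) (z x z' x' : C) (c : chain n z x) (c' : chain n z' x') :
  ctot c = ctot c' -> tot (phi z x c) = tot (phi z' x' c').
Proof.
by move=> h; apply: (ctot_ind (P := fun z' x' c' => tot (phi z x c) = tot (phi z' x' c')) h).
Qed.

Lemma hcast_linear (y y' x x' : C) (ey : y = y') (ex : x = x') :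
  linear (@hcast _ _ y y' x x' ey ex).
Proof. by case: y' / ey; case: x' / ex. Qed.
End TotalMorphisms.

Section CochainAction.
Variables (k : fieldType) (G : groupType) (C : gkcat k G).

Local Notation "s '•' f" := (mact s _ _ f) (at level 30, right associativity).

Lemma tot_mact (s : G) (y x y' x' : C) (f : hom y x) (f' : hom y' x') :
  tot f = tot f' -> tot (s • f) = tot (s • f').
Proof. by case/totP=> ey [ex ->]; case: y' / ey f'; case: x' / ex. Qed.

Lemma tot_mact1 (y x : C) (f : hom y x) : tot (1%g • f) = tot f.
Proof. by rewrite -[in RHS](mact1 f) tot_hcast. Qed.

Lemma tot_mactM t s (y x : C) (f : hom y x) : tot ((t * s)%g • f) = tot (t • s • f).
Proof. by rewrite -mactM tot_hcast. Qed.

Fixpoint gchain (s : G) (n : nat) (z x : C) : chain n z x -> chain n (oact s z) (oact s x) :=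
  match n return chain n z x -> chain n (oact s z) (oact s x) with
  | 0%N => fun e => congr1 (oact s) e
  | n'.+1 => fun c => let: existT y (f, p) := c in ccons (s • f) (gchain s p)
  end.

Lemma gchain_cons s n (z y x : C) (f : hom z y) (p : chain n y x) :
  gchain s (ccons f p) = ccons (s • f) (gchain s p).
Proof. by []. Qed.

Lemma ctot_gchain1 n (z x : C) (c : chain n z x) : ctot (gchain 1%g c) = ctot c.
Proof.
elim: n z c => [|n IH] z c; first by case: x / c => /=; rewrite oact1.
by elim/chain_case: c => y f p; rewrite gchain_cons; apply: ctot_cons (tot_mact1 f) (IH _ _).
Qed.

Lemma ctot_gchainM t s n (z x : C) (c : chain n z x) :
  ctot (gchain (t * s)%g c) = ctot (gchain t (gchain s c)).
Proof.
elim: n z c => [|n IH] z c; first by case: x / c => /=; rewrite oactM.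
elim/chain_case: c => y f p; rewrite !gchain_cons.
exact: ctot_cons (tot_mactM _ _ f) (IH _ _).
Qed.

Lemma ctot_gchainK s n (z x : C) (c : chain n z x) :
  ctot (gchain s^-1%g (gchain s c)) = ctot c.
Proof. by rewrite -ctot_gchainM mulVg ctot_gchain1. Qed.

Lemma ctot_gchainVK s n (z x : C) (c : chain n z x) :
  ctot (gchain s (gchain s^-1%g c)) = ctot c.
Proof. by rewrite -ctot_gchainM mulgV ctot_gchain1. Qed.

Lemma gchain_ind (s : G) n (P : forall z x : C, chain n z x -> Prop) :
  (forall z x c, P (oact s z) (oact s x) (gchain s c)) -> forall z x c, P z x c.
Proof. by move=> h z x c; apply: (ctot_ind (ctot_gchainVK s c)); apply: h. Qed.

Lemma oactVK (s : G) (x : C) : oact s (oact s^-1%g x) = x.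
Proof. by rewrite -oactM mulgV oact1. Qed.

(* The component of s.phi at (z, x) is transported along z = s (s^-1 z) and  *)
(* x = s (s^-1 x).                                                           *)
Definition cact_fun (s : G) n (phi : cfun C n) : cfun C n := fun z x c =>
  hcast (oactVK s z) (oactVK s x) (s • phi _ _ (gchain s^-1%g c)).

Lemma multilinear_gchain s n (z x : C) (M : lmodType k)
    (phi : chain n (oact s z) (oact s x) -> M) :
  multilinear phi -> multilinear (fun c : chain n z x => phi (gchain s c)).
Proof.
elim: n z phi => [//|n IH] z phi [h1 h2]; split=> [y p|y f].
  by move=> a u v; rewrite !gchain_cons linearP h1.
exact: (IH y (fun p => phi (ccons (s • f) p)) (h2 _ (s • f))).
Qed.

Fact cact_multi s n (phi : cochain C n) : is_cochain (@cact_fun s n (cval phi)).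
Proof.
move=> z x; apply: (@multilinear_lin _ _ _ _ _ _ _
   (fun c => cval phi (gchain s^-1%g c))
   (fun f => hcast (oactVK s z) (oactVK s x) (s • f))).
  by move=> a f g; rewrite linearP hcast_linear.
exact: multilinear_gchain (subm_in phi _ _).
Qed.

Definition cact (n : nat) (s : G) (phi : cochain C n) : cochain C n :=
  mksub (S := cochain_submod C n) (@cact_multi s n phi).

Lemma cval_cact s n (phi : cochain C n) (z x : C) (c : chain n z x) :
  cval (cact s phi) (gchain s c) = s • cval phi c.
Proof.
apply: tot_inj; rewrite tot_hcast; apply/tot_mact.
exact: (tot_cfun (cval phi) (ctot_gchainK s c)).
Qed.

Lemma cochain_eq_gchain s n (phi psi : cochain C n) :
  (forall (z x : C) (c : chain n z x), cval phi (gchain s c) = cval psi (gchain s c)) ->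
  phi = psi.
Proof. by move=> h; apply: cochain_inj; apply: (gchain_ind (s := s)). Qed.

Fact cact_linear n s : linear (@cact n s).
Proof.
move=> a phi psi; apply: (@cochain_eq_gchain s) => z x c.
by rewrite cvalP !cval_cact cvalP linearP.
Qed.
HB.instance Definition _ n s :=
  GRing.isLinear.Build k (cochain C n) (cochain C n) _ (@cact n s) (@cact_linear n s).

Fact cact1 n (phi : cochain C n) : cact 1%g phi = phi.
Proof.
apply: cochain_inj => z x c; apply: tot_inj.
rewrite -(tot_cfun (cval (cact 1%g phi)) (ctot_gchain1 c)).
by rewrite cval_cact tot_mact1.
Qed.

Fact cactM n t s (phi : cochain C n) : cact (t * s)%g phi = cact t (cact s phi).
Proof.
apply: (@cochain_eq_gchain t); apply: (gchain_ind (s := s)) => z x c.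
rewrite !cval_cact; apply: tot_inj.
rewrite -(tot_cfun (cval (cact (t * s)%g phi)) (ctot_gchainM t s c)).
by rewrite cval_cact tot_mactM.
Qed.

Definition kequiv s n (z y : C) (psi : kfun z y n) (chi : kfun (oact s z) (oact s y) n) :=
  forall x (c : chain n y x), chi (oact s x) (gchain s c) = s • psi x c.

Lemma kequiv_cons s n (z y w : C) (psi : kfun z y n.+1) chi (f : hom y w) :
  @kequiv s n.+1 z y psi chi -> @kequiv s n z w (kcons psi f) (kcons chi (s • f)).
Proof. by move=> h x c; apply: (h x (ccons f c)). Qed.

Lemma mact_hcast s (y x x' : C) (e : x = x') (f : hom y x) :
  s • hcast erefl e f = hcast erefl (congr1 (oact s) e) (s • f).
Proof. by case: x' / e. Qed.

Lemma kequiv_rmod s n (z y w : C) (psi : kfun z y n) chi (f : hom y w) :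
  @kequiv s n z y psi chi ->
  @kequiv s n z w (@rmod _ _ n z y w psi f) (@rmod _ _ n _ _ _ chi (s • f)).
Proof.
case: n psi chi => [|n] psi chi h x c.
  rewrite -[LHS]/(comp (chi _ (gchain s (erefl y : chain 0 y y)))
    (hcast erefl (congr1 (oact s) c) (s • f))).
  by rewrite h -mact_hcast -mact_comp.
elim/chain_case: c => v g q; rewrite -[rmod psi _ _]/(psi x (ccons (comp f g) q)) -h.
by rewrite [gchain s (ccons (comp f g) q)]gchain_cons mact_comp.
Qed.

Lemma kequiv_dk s n (z y : C) (psi : kfun z y n) chi :
  @kequiv s n z y psi chi ->
  @kequiv s n.+1 z y (@dk _ _ n _ _ psi) (@dk _ _ n _ _ chi).
Proof.
elim: n y psi chi => [|n IH] y psi chi h x; elim/chain_case=> w f p.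
  exact: (@kequiv_rmod s 0 z y w psi chi f h x p).
rewrite gchain_cons !dk_cons linearD linearZZ.
rewrite (@kequiv_rmod s n.+1 z y w psi chi f h x p).
by rewrite (IH w (kcons psi f) (kcons chi (s • f)) (kequiv_cons f h)).
Qed.

Fact cact_cobd s n (phi : cochain C n) : cact s (cobd phi) = cobd (cact s phi).
Proof.
apply: (@cochain_eq_gchain s) => z x; elim/chain_case=> y f p.
rewrite cval_cact gchain_cons !cval_cobd !cobdE cval_cact.
rewrite linearD linearZZ mact_comp; congr (_ + _).
symmetry; apply: (@kequiv_dk s n z z _ _ _ x (ccons f p)) => x' c.
exact: cval_cact.
Qed.

Lemma kequiv_cup s m n (z y : C) (psi : kfun z y m) chi (phi : cochain C n) :
  @kequiv s m z y psi chi ->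
  @kequiv s (m + n)%N z y (@kcup _ _ m n z y psi (cval phi))
     (@kcup _ _ m n _ _ chi (cval (cact s phi))).
Proof.
elim: m y psi chi => [|m IH] y psi chi h x c.
  rewrite !kcup0 -[chi _ erefl]/(chi _ (gchain s (erefl y : chain 0 y y))) h.
  by rewrite -[gchain s (n := 0 + n) c]/(gchain s (n := n) c) cval_cact mact_comp.
elim/chain_case: c => w f p.
have E1 := @kcupS _ _ m n z y w x psi (cval phi) f p.
have E2 := @kcupS _ _ m n _ _ _ (oact s x) chi (cval (cact s phi)) (s • f) (gchain s p).
apply: etrans E2 _; rewrite [X in _ = s • X]E1.
exact: (IH w (kcons psi f) (kcons chi (s • f)) (kequiv_cons f h)).
Qed.

Fact cact_cup s m n (psi : cochain C m) (phi : cochain C n) :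
  cact s (cup psi phi) = cup (cact s psi) (cact s phi).
Proof.
apply: (@cochain_eq_gchain s) => z x c; rewrite cval_cact !cval_cup.
symmetry; apply: (@kequiv_cup s m n z z) => x' d; exact: cval_cact.
Qed.

Fact cact_unit s : cact s (cunit C) = cunit C.
Proof.
apply: (@cochain_eq_gchain s) => z x e; rewrite cval_cact.
by case: x / e; apply: mact_id.
Qed.

Definition coch_act n : action G (cochain C n) :=
  @Action k G (cochain C n) (fun s => @cact n s : {linear _ -> _}) (@cact1 n) (@cactM n).

Definition hoch_galg_action : galg_action G (hoch_dga C) :=
  @GAlgAction k G (hoch_dga C) coch_act cact_unit cact_cup.

Definition hoch_action : dga_action G (hoch_dga C) :=
  @DGAAction k G (hoch_dga C) hoch_galg_action cact_cobd.

Definition coh_inv_cochains : galg k := cohomology (inv_dga hoch_action).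
Definition HH_inv : galg k := inv_galg (coh_action hoch_action).
End CochainAction.

Section DirectSum.
Variables (k : fieldType) (I : choiceType) (V : I -> lmodType k).

Definition fin_supp (f : dprod V) : Prop := finite_set [set i | f i <> 0]%classic.

Fact fin_supp0 : fin_supp 0.
Proof. by apply: (sub_finite_set (B := set0)) => // i /=. Qed.
Fact fin_suppP a f g : fin_supp f -> fin_supp g -> fin_supp (a *: f + g).
Proof.
move=> hf hg; apply: (sub_finite_set (B := [set i | f i <> 0] `|` [set i | g i <> 0])%classic).
  move=> i /= h; apply: contrapT => /not_orP[/contrapT f0 /contrapT g0].
  by apply: h; rewrite dprodPE f0 g0 scaler0 addr0.
by rewrite finite_setU.
Qed.

Definition dsum : lmodType k := subm (Submod fin_supp0 fin_suppP).

Definition dval (f : dsum) : forall i, V i := subm_val f.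

Lemma dsum_inj (f g : dsum) : (forall i, dval f i = dval g i) -> f = g.
Proof. by move=> h; apply: subm_inj; apply: functional_extensionality_dep. Qed.
Lemma dvalP a (f g : dsum) i : dval (a *: f + g) i = a *: dval f i + dval g i.
Proof. by rewrite /dval subm_valP. Qed.
Lemma dvalD (f g : dsum) i : dval (f + g) i = dval f i + dval g i.
Proof. by rewrite /dval subm_valD. Qed.
Lemma dval0 i : dval 0 i = 0.
Proof. by rewrite -[0](scale0r (0 : dsum)) /dval subm_valZ dprodZE scale0r. Qed.
Lemma dval_sum (J : Type) (r : seq J) (P : pred J) (F : J -> dsum) i :
  dval (\sum_(j <- r | P j) F j) i = \sum_(j <- r | P j) dval (F j) i.
Proof.
elim: r => [|j r IH]; first by rewrite !big_nil dval0.
by rewrite !big_cons; case: (P j); rewrite // dvalD IH.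
Qed.

(* The element with component v in degree i. *)
Definition dinj_fun i (v : V i) : dprod V :=
  @dfwith I (fun j => V j) (fun j => 0) i v.
Fact dinj_supp i (v : V i) : fin_supp (dinj_fun v).
Proof.
apply: (sub_finite_set (B := [set i]%classic)); last exact: finite_set1.
move=> j /= h; apply: contrapT => nij; apply: h; rewrite /dinj_fun dfwith_out //.
by apply/eqP => e; apply: nij.
Qed.
Definition dinj i (v : V i) : dsum := mksub (S := Submod fin_supp0 fin_suppP) (dinj_supp v).

Lemma dinj_in i (v : V i) : dval (dinj v) i = v.
Proof. exact: dfwith_in. Qed.
Lemma dinj_out i j (v : V i) : i != j -> dval (dinj v) j = 0.
Proof. exact: dfwith_out. Qed.

Lemma dinj_linear i : linear (@dinj i).
Proof.
move=> a u v; apply: dsum_inj => j; rewrite dvalP.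
have [<-|nij] := eqVneq i j; first by rewrite !dinj_in.
by rewrite !dinj_out // scaler0 addr0.
Qed.

Definition dsupp (f : dsum) : {fset I} := fset_set [set i | dval f i <> 0]%classic.
Lemma dsupp0 (f : dsum) i : i \notin dsupp f -> dval f i = 0.
Proof.
rewrite in_fset_set; last exact: (subm_in f).
by rewrite notin_setE /= => /contrapT.
Qed.

Lemma dsum_decomp (f : dsum) : f = \sum_(i <- dsupp f) dinj (dval f i).
Proof.
apply: dsum_inj => j; rewrite dval_sum; have [jf|jf] := boolP (j \in dsupp f).
  rewrite (bigD1_seq j) // dinj_in big1; first by rewrite /= addr0.
  by move=> i nij; rewrite dinj_out.
rewrite dsupp0 // big_seq big1 // => i hi; rewrite dinj_out //.
by apply/eqP => e; rewrite -e hi in jf.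
Qed.

Lemma dsum_ind (P : dsum -> Prop) :
  P 0 -> (forall f g, P f -> P g -> P (f + g)) -> (forall i v, P (@dinj i v)) ->
  forall f, P f.
Proof. by move=> h0 hD hi f; rewrite (dsum_decomp f); elim/big_ind: _. Qed.

Section Lift.
Variable W : lmodType k.
Implicit Type L : forall i, V i -> W.

Definition dlift L (f : dsum) : W := \sum_(i \in [set: I]%classic) L i (dval f i).

Lemma dliftE L (f : dsum) (A : {fset I}) :
  (forall i, L i 0 = 0) -> {subset dsupp f <= A} ->
  dlift L f = \sum_(i <- A) L i (dval f i).
Proof.
move=> L0 fA; apply: fsbigTE => i iA; rewrite dsupp0 //.
by apply: contra iA; apply: fA.
Qed.

Lemma linear_0 (U : lmodType k) (F : U -> W) : linear F -> F 0 = 0.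
Proof. by move=> lF; have := lF (-1) 0 0; rewrite scaler0 addr0 scaleN1r addNr. Qed.

Lemma dlift_linear L : (forall i, linear (L i)) -> linear (dlift L).
Proof.
move=> lL a f g; have L0 i := linear_0 (lL i).
pose A := (dsupp (a *: f + g) `|` (dsupp f `|` dsupp g))%fset.
rewrite !(@dliftE _ _ A) //; last first.
- by move=> i hi; rewrite !inE hi.
- by move=> i hi; rewrite !inE hi !orbT.
- by move=> i hi; rewrite !inE hi !orbT.
rewrite scaler_sumr -big_split; apply: eq_bigr => i _.
by rewrite dvalP lL.
Qed.

Lemma dlift_dinj L i (v : V i) : (forall i, L i 0 = 0) -> dlift L (dinj v) = L i v.
Proof.
move=> L0; rewrite (@dliftE _ _ [fset i]%fset) //.
  by rewrite big_seq_fset1 dinj_in.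
move=> j; apply: contraLR; rewrite inE => nij.
rewrite in_fset_set; last exact: (dinj_supp v).
by rewrite notin_setE => h; apply: h; apply: dinj_out; rewrite eq_sym.
Qed.

Lemma dliftP a L L' (f : dsum) :
  (forall i, L i 0 = 0) -> (forall i, L' i 0 = 0) ->
  dlift (fun i v => a *: L i v + L' i v) f = a *: dlift L f + dlift L' f.
Proof.
move=> L0 L'0; rewrite !(@dliftE _ _ (dsupp f)) //.
  by rewrite scaler_sumr -big_split.
by move=> i; rewrite L0 L'0 scaler0 addr0.
Qed.
End Lift.
End DirectSum.

Section Skew.
Variables (k : fieldType) (G : groupType) (C : gkcat k G).

Definition skew_hom (y x : C) : lmodType k := dsum (fun s : G => hom y (oact s x)).

Definition skew_of (s : G) (y x : C) (f : hom y (oact s x)) : skew_hom y x :=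
  @dinj k G (fun s => hom y (oact s x)) s f.

(* The composite g (t f), for f of degree s and g of degree t. *)
Definition skew_comp1 (t s : G) (z y x : C) (g : hom z (oact t y))
    (f : hom y (oact s x)) : hom z (oact (t * s)%g x) :=
  hcast erefl (esym (oactM t s x)) (comp g (mact t y (oact s x) f)).

Definition skew_comp (z y x : C) (g : skew_hom z y) (f : skew_hom y x) : skew_hom z x :=
  \sum_(t \in [set: G]%classic) \sum_(s \in [set: G]%classic)
     skew_of (skew_comp1 (dval g t) (dval f s)).

Definition skew_id (x : C) : skew_hom x x :=
  skew_of (hcast erefl (esym (oact1 x)) (idm x)).

Lemma skew_of_eq (s s' : G) (y x : C) (f : hom y (oact s x)) (f' : hom y (oact s' x)) :
  s = s' -> tot f = tot f' -> skew_of f = skew_of f'.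
Proof. by move=> e; case: s' / e f' => f' /tot_inj ->. Qed.

Lemma skew_of_linear s (y x : C) : linear (@skew_of s y x).
Proof. exact: dinj_linear. Qed.

Lemma skew_ind (y x : C) (P : skew_hom y x -> Prop) :
  P 0 -> (forall f g, P f -> P g -> P (f + g)) -> (forall s f, P (@skew_of s y x f)) ->
  forall f, P f.
Proof. exact: dsum_ind. Qed.

Lemma skew_comp1Pl (t s : G) (z y x : C) a (g g' : hom z (oact t y)) (f : hom y (oact s x)) :
  skew_comp1 (a *: g + g') f = a *: skew_comp1 g f + skew_comp1 g' f.
Proof. by rewrite /skew_comp1 compPl hcast_linear. Qed.
Lemma skew_comp1Pr (t s : G) (z y x : C) a (g : hom z (oact t y)) (f f' : hom y (oact s x)) :
  skew_comp1 g (a *: f + f') = a *: skew_comp1 g f + skew_comp1 g f'.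
Proof. by rewrite /skew_comp1 linearP compPr hcast_linear. Qed.

Let L1 (z y x : C) (t : G) (g : hom z (oact t y)) (s : G) (f : hom y (oact s x)) :=
  skew_of (skew_comp1 g f).

Fact L1_linr (z y x : C) t (g : hom z (oact t y)) s : linear (@L1 z y x t g s).
Proof. by move=> a f f'; rewrite /L1 skew_comp1Pr skew_of_linear. Qed.
Fact L1_r0 (z y x : C) t (g : hom z (oact t y)) s : @L1 z y x t g s 0 = 0.
Proof. exact: linear_0 (L1_linr g (s := s)). Qed.

Lemma skew_compE (z y x : C) (g : skew_hom z y) (f : skew_hom y x) :
  skew_comp g f = dlift (fun t (g : hom z (oact t y)) => dlift (@L1 z y x t g) f) g.
Proof. by []. Qed.

Fact L2_lin (z y x : C) (f : skew_hom y x) t :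
  linear (fun g : hom z (oact t y) => dlift (@L1 z y x t g) f).
Proof.
move=> a g g'; rewrite -dliftP; [|exact: L1_r0|exact: L1_r0].
by congr dlift; apply: functional_extensionality_dep => s; apply: funext => h;
   rewrite /L1 skew_comp1Pl skew_of_linear.
Qed.

Lemma skew_compPl (z y x : C) a (g g' : skew_hom z y) (f : skew_hom y x) :
  skew_comp (a *: g + g') f = a *: skew_comp g f + skew_comp g' f.
Proof. rewrite !skew_compE; apply: dlift_linear; exact: L2_lin. Qed.

Lemma skew_compPr (z y x : C) a (g : skew_hom z y) (f f' : skew_hom y x) :
  skew_comp g (a *: f + f') = a *: skew_comp g f + skew_comp g f'.
Proof.
rewrite !skew_compE -dliftP; last 2 first.
- by move=> t; apply: linear_0 (L2_lin f (t := t)).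
- by move=> t; apply: linear_0 (L2_lin f' (t := t)).
congr dlift; apply: functional_extensionality_dep => t; apply: funext => h.
by apply: dlift_linear => s; apply: L1_linr.
Qed.

Lemma skew_compof (t s : G) (z y x : C) (g : hom z (oact t y)) (f : hom y (oact s x)) :
  skew_comp (skew_of g) (skew_of f) = skew_of (skew_comp1 g f).
Proof.
rewrite skew_compE dlift_dinj; last by move=> u; apply: linear_0 (L2_lin _ (t := u)).
by rewrite dlift_dinj //; apply: L1_r0.
Qed.

Lemma skew_compDl (z y x : C) (g g' : skew_hom z y) (f : skew_hom y x) :
  skew_comp (g + g') f = skew_comp g f + skew_comp g' f.
Proof. by rewrite -[g]scale1r skew_compPl !scale1r. Qed.
Lemma skew_compDr (z y x : C) (g : skew_hom z y) (f f' : skew_hom y x) :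
  skew_comp g (f + f') = skew_comp g f + skew_comp g f'.
Proof. by rewrite -[f]scale1r skew_compPr !scale1r. Qed.
Lemma skew_comp0l (z y x : C) (f : skew_hom y x) : skew_comp (0 : skew_hom z y) f = 0.
Proof. by apply: (addIr (skew_comp 0 f)); rewrite -skew_compDl addr0 add0r. Qed.
Lemma skew_comp0r (z y x : C) (g : skew_hom z y) : skew_comp g (0 : skew_hom y x) = 0.
Proof. by apply: (addIr (skew_comp g 0)); rewrite -skew_compDr addr0 add0r. Qed.

Fact skew_compA (w z y x : C) (f : skew_hom w z) (g : skew_hom z y) (h : skew_hom y x) :
  skew_comp f (skew_comp g h) = skew_comp (skew_comp f g) h.
Proof.
elim/skew_ind: f => [|f f' Hf Hf'|r f]; first by rewrite !skew_comp0l.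
  by rewrite !skew_compDl Hf Hf'.
elim/skew_ind: g => [|g g' Hg Hg'|t g]; first by rewrite skew_comp0r !skew_comp0l skew_comp0r.
  by rewrite skew_compDl !skew_compDr skew_compDl Hg Hg'.
elim/skew_ind: h => [|h h' Hh Hh'|s h]; first by rewrite !skew_comp0r.
  by rewrite !skew_compDr Hh Hh'.
rewrite !skew_compof; apply: skew_of_eq; first exact: mulgA.
rewrite /skew_comp1 !tot_hcast.
transitivity (tot (comp f (comp (mact r _ _ g) (mact r _ _ (mact t _ _ h))))).
  by apply: tot_comp => //; rewrite -mact_comp; apply: tot_mact; rewrite tot_hcast.
rewrite compA; apply: tot_comp; first by rewrite tot_hcast.
by rewrite tot_mactM.
Qed.

Fact skew_comp1m (y x : C) (f : skew_hom y x) : skew_comp (skew_id y) f = f.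
Proof.
elim/skew_ind: f => [|f f' Hf Hf'|s f]; first by rewrite skew_comp0r.
  by rewrite skew_compDr Hf Hf'.
rewrite skew_compof; apply: skew_of_eq; first exact: mul1g.
rewrite tot_hcast -[in RHS](comp1m f); apply: tot_comp; first by rewrite tot_hcast.
exact: tot_mact1.
Qed.

Fact skew_compm1 (y x : C) (f : skew_hom y x) : skew_comp f (skew_id x) = f.
Proof.
elim/skew_ind: f => [|f f' Hf Hf'|s f]; first by rewrite skew_comp0l.
  by rewrite skew_compDl Hf Hf'.
rewrite skew_compof; apply: skew_of_eq; first exact: mulg1.
rewrite tot_hcast -[in RHS](compm1 f); apply: tot_comp => //.
by rewrite -mact_id; apply: tot_mact; rewrite tot_hcast.
Qed.

Definition skew_cat : kcat k :=
  @KCat k C skew_hom skew_comp skew_id skew_compPl skew_compPr skew_compA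
    skew_comp1m skew_compm1.

Definition skew_deg (s : G) (y x : C) (f : skew_hom y x) : Prop :=
  exists f0 : hom y (oact s x), f = skew_of f0.

Fact skew_deg0 s (y x : C) : @skew_deg s y x 0.
Proof. by exists 0; rewrite (linear_0 (@skew_of_linear s y x)). Qed.
Fact skew_degP s (y x : C) a (f g : skew_hom y x) :
  skew_deg s f -> skew_deg s g -> skew_deg s (a *: f + g).
Proof. by case=> f0 -> [g0 ->]; exists (a *: f0 + g0); rewrite skew_of_linear. Qed.

Definition skew_gr (s : G) (y x : skew_cat) : submod (hom y x) :=
  @Submod k (hom y x) (@skew_deg s y x) (@skew_deg0 s y x) (@skew_degP s y x).

Fact skew_sum (y x : skew_cat) : direct_sum (fun s => skew_gr s y x).
Proof.
split=> [f|r w ur hw w0 s sr].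
  exists (dsupp f), (fun s => skew_of (dval f s)); split; last exact: dsum_decomp.
  by move=> s; exists (dval f s).
have [f0 ws] := hw s; rewrite ws.
have : dval (\sum_(s <- r) w s : skew_hom y x) s = 0 by rewrite w0 dval0.
rewrite dval_sum (bigD1_seq s) // big1; last first.
  by move=> t nts; have [g ->] := hw t; apply: dinj_out.
by rewrite ws dinj_in /= addr0 => ->; apply: linear_0 (@skew_of_linear s y x).
Qed.

Fact skew_gr_comp (t s : G) (z y x : skew_cat) (g : hom z y) (f : hom y x) :
  skew_gr t z y g -> skew_gr s y x f -> skew_gr (t * s)%g z x (comp g f).
Proof. by case=> g0 -> [f0 ->]; exists (skew_comp1 g0 f0); apply: skew_compof. Qed.

Fact skew_gr_id (x : skew_cat) : skew_gr 1%g x x (idm x).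
Proof. by exists (hcast erefl (esym (oact1 x)) (idm (x : C))). Qed.

Definition skew_category : grkcat k G :=
  @GrKCat k G skew_cat skew_gr skew_sum skew_gr_id skew_gr_comp.
End Skew.

(* Main.v *)
From HB Require Import structures.
From mathcomp Require Import all_boot all_algebra.
From mathcomp Require Import boolp.
Require Import Defs.

Set Implicit Arguments.
Unset Strict Implicit.
Unset Printing Implicit Defensive.

Import GRing.Theory.
Local Open Scope ring_scope.

(** Write B for the skew category.  The two complexes are compared by the map
skew_ext, which sends an invariant cochain phi of C to the cochain of B whose
value on homogeneous morphisms f_n, ..., f_1 of degrees s_n, ..., s_1 is
    phi (f_n, s_n f_(n-1), s_n s_(n-1) f_(n-2), ..., (s_n ... s_2) f_1),
placed in degree s_n ... s_1.  It preserves degrees, units and cup products,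
and commutes with the coboundaries; on the morphisms of degree 1 it gives
phi back, so it is injective (skew_ext_inj).

For every object x and every s in G, the identity of s x is an isomorphism of
B from x to s x, of degree s: call it a shift.  The image of skew_ext consists
of the cochains which are relative to the shifts: a shift can be moved across a
tensor sign, and taken out at the left end (kbalanced_kskew, kcomp_shift, and
skew_ext_onto for the converse).

Freeness makes the relative cochains a deformation retract of all
degree-preserving ones.  Choose a representative tau x in the orbit of each
object; freeness gives a unique sigma x with x = (sigma x) (tau x), hence
sigma (s x) = s (sigma x).  Let u_x : tau x -> x be the shift of degree
sigma x.  Conjugation by the u_x is a functor N from B to B, isomorphic to the
identity functor, which sends every shift to an identity (conj_shift).  So
    phi |-> u phi(N f_n, ..., N f_1) u^-1
is a retraction onto the relative cochains (cconj_onto, cconj_skew_ext).  The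
homotopy that a natural isomorphism provides connects it to the identity
(cconj_htpyS), and that homotopy preserves degrees (deg_chtpy), although N does
not.  This gives the first isomorphism (HH1_skew).

For the second one, let A be any differential graded algebra with an action of
G.  When taking invariants is exact, every invariant class has an invariant
cocycle, and an invariant coboundary is the coboundary of an invariant cochain;
so the cohomology of the invariants is the invariant part of the cohomology
(exact_coh_inv). *)

(** * Isomorphisms of graded algebras and of cohomology algebras *)
Section GradedIsomorphisms.
Variable k : fieldType.

Lemma linear_bij_inv (U V : lmodType k) (f : {linear U -> V}) :
  bijective f -> exists g : {linear V -> U}, cancel f g /\ cancel g f.
Proof.
case=> g fK gK.
have g_lin : linear g.
  by move=> a u v; apply: (can_inj fK); rewrite linearP !gK.
pose gL := GRing.isLinear.Build k V U _ g g_lin.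
by exists (HB.pack_for {linear V -> U} g gL).
Qed.

Lemma galg_isom_sym (A B : galg k) : galg_isom A B -> galg_isom B A.
Proof.
case=> f [f_bij f1 fM].
have finv n := cid (linear_bij_inv (f_bij n)).
pose g n := projT1 (finv n); have gP n := projT2 (finv n) : cancel (f n) (g n) /\ _.
exists g; split.
- by move=> n; case: (gP n) => fK gK; exists (f n).
- by case: (gP 0%N) => fK gK; rewrite -f1 fK.
- move=> m n a b; case: (gP (m + n)%N) => fK _.
  by case: (gP m) => _ gmK; case: (gP n) => _ gnK; rewrite -[RHS]fK fM gmK gnK.
Qed.

Lemma galg_isom_trans (A B D : galg k) :
  galg_isom A B -> galg_isom B D -> galg_isom A D.
Proof.
case=> f [f_bij f1 fM] [g [g_bij g1 gM]].
exists (fun n => (g n \o f n : {linear _ -> _})); split=> [n||m n a b] /=.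
- exact: (bij_comp (g_bij n) (f_bij n)).
- by rewrite f1 g1.
- by rewrite fM gM.
Qed.
End GradedIsomorphisms.

Section InducedMap.
Variables (k : fieldType) (A : dga k) (B : galg k).
Variable F : forall n, {linear subm (cocycles A n) -> B n}.
Arguments F : clear implicits.

Hypothesis F0 : forall n (a : subm (cocycles A n)),
  is_coboundary (subm_val a) <-> F n a = 0.
Hypothesis F_surj : forall n (b : B n), exists a, F n a = b.
Hypothesis F1 : F 0 (mksub (S := cocycles A 0) (cocycle1 A)) = gone B.
Hypothesis FM : forall m n (a : subm (cocycles A m)) (b : subm (cocycles A n)),
  F (m + n) (mul_cocycles a b) = gmul (F m a) (F n b).

Definition coh_map n (x : coh A n) : B n := F n (rep x).

Lemma coh_mapE n (a : subm (cocycles A n)) : coh_map (hcls a) = F n a.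
Proof.
apply/eqP; rewrite -subr_eq0 -linearB; apply/eqP/F0.
exact: (rep_cls (coboundaries A n) a).
Qed.

Fact coh_map_linear n : linear (@coh_map n).
Proof.
move=> c; elim/hcls_ind=> a; elim/hcls_ind=> b.
by rewrite -hclsP_lin !coh_mapE linearP.
Qed.
HB.instance Definition _ n :=
  GRing.isLinear.Build k (coh A n) (B n) _ (@coh_map n) (@coh_map_linear n).

(** A graded algebra onto which the cocycles map multiplicatively, with the
coboundaries as kernel, is the cohomology algebra.  Both isomorphisms of the
main theorem come from such a map. *)
Lemma cohomology_isom : galg_isom (cohomology A) B.
Proof.
exists (fun n => @coh_map n : {linear _ -> _}); split=> /=.
- move=> n; have [g gK] := boolp.choice (@F_surj n).
  exists (fun b => hcls (g b)); last by move=> b; rewrite /= coh_mapE.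
  elim/hcls_ind=> a; rewrite /= coh_mapE; apply/clsP.
  by apply/F0; rewrite linearB /= gK subrr.
- by rewrite /hone coh_mapE.
- move=> m n; elim/hcls_ind=> a; elim/hcls_ind=> b.
  by rewrite hmulE !coh_mapE FM.
Qed.
End InducedMap.

Section QuasiIsomorphism.
Variables (k : fieldType) (A B : dga k) (f : forall n, {linear A n -> B n}).
Variable h : forall n, {linear B n.+1 -> B n}.
Arguments f : clear implicits.

(** The operator dh + hd, which is only hd in degree 0. *)
Definition htpy n : B n -> B n :=
  match n with
  | 0%N => fun b => h 0 (dgd B 0 b)
  | n'.+1 => fun b => dgd B n' (h n' b) + h n'.+1 (dgd B n'.+1 b)
  end.

(** The last two hypotheses say that 1 + dh + hd is a retraction of B onto the
image of f: its values lie in the image, and it fixes the image. *)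
Hypothesis f_inj : forall n, injective (f n).
Hypothesis f1 : f 0 (gone A) = gone B.
Hypothesis fM : forall m n (a : A m) (b : A n),
  f (m + n) (gmul a b) = gmul (f m a) (f n b).
Hypothesis fd : forall n (a : A n), f n.+1 (dgd A n a) = dgd B n (f n a).
Hypothesis htpy_retr : forall n (b : B n), exists a, f n a = b + htpy b.
Hypothesis htpy_f : forall n (a : A n), htpy (f n a) = 0.

Lemma htpy_cocycle n (b : B n) : is_cocycle b -> is_coboundary (htpy b).
Proof.
case: n b => [|n] b b0; rewrite /= b0 linear0 //.
by exists (h n b); rewrite addr0.
Qed.

Lemma htpy_d n (b : B n) : htpy (dgd B n b) = dgd B n (htpy b).
Proof.
case: n b => [|n] b /=; first by rewrite dgdd linear0 addr0.
by rewrite dgdd linear0 addr0 linearD dgdd add0r.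
Qed.

(** If f a = d b, apply the retraction to b: the result is f a' for some a', and
its coboundary is still d b = f a, because dh + hd commutes with d and vanishes
on f a. *)
Lemma f_coboundary n (a : A n) : is_coboundary (f n a) -> is_coboundary a.
Proof.
case: n a => [|n] a /=; first by rewrite -(linear0 (f 0)) => /f_inj.
case=> b ab; have [a' a'b] := htpy_retr b; exists a'; apply: f_inj.
by rewrite fd a'b linearD -htpy_d -ab htpy_f addr0.
Qed.

Fact f_cocycle n (a : A n) : cocycles A n a -> cocycles B n (f n a).
Proof. by move=> a0; rewrite /= /is_cocycle -fd a0 linear0. Qed.

Definition coc_map n (a : subm (cocycles A n)) : coh B n :=
  hcls (mksub (f_cocycle (subm_in a))).

Fact coc_map_linear n : linear (@coc_map n).
Proof.
move=> c a b; rewrite -hclsP_lin; congr hcls; apply: subm_inj.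
by rewrite mksubE [RHS]subm_valP !mksubE subm_valP linearP.
Qed.
HB.instance Definition _ n :=
  GRing.isLinear.Build k (subm (cocycles A n)) (coh B n) _ (@coc_map n)
    (@coc_map_linear n).

Lemma hcls_eq0 n (b : subm (cocycles B n)) : hcls b = 0 <-> is_coboundary (subm_val b).
Proof.
rewrite -(linear0 (cls (coboundaries B n))); split.
  by move/clsP; rewrite subr0.
by move=> hb; apply/clsP; rewrite subr0.
Qed.

(** The inclusion of a deformation retract: a cocycle b is cohomologous to its
retraction b + (dh + hd) b = b + d (h b). *)
Theorem quasi_isom : galg_isom (cohomology A) (cohomology B).
Proof.
apply: (@cohomology_isom _ A (cohomology B) (fun n => @coc_map n : {linear _ -> _})) => /=.
- move=> n a; rewrite hcls_eq0 mksubE; split; last exact: f_coboundary.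
  case: n a => [|n] a /=; first by move=> ->; rewrite linear0.
  by case=> a' ->; exists (f n a'); rewrite fd.
- move=> n; elim/hcls_ind=> b; have [a ab] := htpy_retr (subm_val b).
  have hb := htpy_cocycle (subm_in b).
  have a0 : cocycles A n a.
    have htpy0 : htpy (0 : B n.+1) = 0 by have := htpy_f (0 : A n.+1); rewrite linear0.
    rewrite /= /is_cocycle; apply: f_inj.
    by rewrite linear0 fd ab linearD -htpy_d (subm_in b) htpy0 addr0.
  (* Here b + (dh + hd) b - b is the coboundary of h b. *)
  exists (mksub a0); apply/clsP.
  change (is_coboundary (subm_val (mksub (f_cocycle (subm_in (mksub a0))) - b))).
  by rewrite subm_valB !mksubE ab addrC addKr.
- by congr hcls; apply: subm_inj; rewrite !mksubE.
- move=> m n a b; rewrite hmulE; congr hcls; apply: subm_inj.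
  by rewrite !mksubE fM.
Qed.
End QuasiIsomorphism.

(** * Exact invariants and cohomology *)
Section Subactions.
Variables (k : fieldType) (G : groupType).
Variables (V : lmodType k) (S : submod V) (ra : action G V).
Hypothesis S_act : forall s v, S v -> S (ra s v).

Definition sub_act_fun s (v : subm S) : subm S := mksub (S_act s (subm_in v)).

Fact sub_act_linear s : linear (sub_act_fun s).
Proof.
by move=> a u v; apply: subm_inj; rewrite subm_valP !mksubE subm_valP linearP.
Qed.
HB.instance Definition _ s :=
  GRing.isLinear.Build k (subm S) (subm S) _ (sub_act_fun s) (sub_act_linear s).

Definition sub_act : action G (subm S).
Proof.
refine (@Action k G (subm S) (fun s => sub_act_fun s : {linear _ -> _}) _ _).
- by move=> v; apply: subm_inj; rewrite mksubE act1.
- by move=> t s v; apply: subm_inj; rewrite !mksubE actM.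
Defined.
End Subactions.

Section ExactInvariants.
Variables (k : fieldType) (G : groupType).
Hypothesis exactG : invariants_exact k G.

Section Surjection.
Variables (M N : kGmod k G) (g : kGhom M N).
Hypothesis g_surj : forall w, exists v, g v = w.

Fact ker_submodP a u v : g u = 0 -> g v = 0 -> g (a *: u + v) = 0.
Proof. by move=> gu gv; rewrite linearP gu gv scaler0 addr0. Qed.
Definition ker_submod : submod M := Submod (linear0 g) ker_submodP.

Fact ker_stable s v : ker_submod v -> ker_submod (kG_act M s v).
Proof. by move=> /= gv; rewrite kG_equiv gv linear0. Qed.

Definition ker_incl : kGhom (KGMod (sub_act ker_stable)) M :=
  @KGHom k G (KGMod (sub_act ker_stable)) M (\val : {linear subm ker_submod -> M})
    (fun s v => erefl).

(** Exactness applied to the short exact sequence ker g -> M -> N.  It is used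
for the two surjections that define cohomology: d onto the coboundaries, and the
projection of the cocycles onto the classes. *)
Lemma invariant_lift w : invariants (kG_act N) w ->
  exists2 v, invariants (kG_act M) v & g v = w.
Proof.
move=> hw; have ex : short_exact ker_incl g.
  split=> [u v|v|w'].
  - exact: subm_inj.
  - split; first by move=> gv; exists (mksub (S := ker_submod) gv).
    by case=> u ->; apply: (subm_in u).
  - exact: g_surj.
have [_ _ /(_ (mksub hw))[v vw]] := exactG ex.
by exists (subm_val v); [apply: subm_in | have := congr1 (@subm_val _ _ _) vw].
Qed.
End Surjection.

Variables (A : dga k) (r : dga_action G A).

Section CoboundaryLift.
Variable n : nat.

Definition cob_submod : submod (A n.+1) :=
  Submod (@coboundary0 k A n.+1) (@coboundaryP k A n.+1).

Definition cob_kGmod : kGmod k G :=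
  KGMod (@sub_act k G _ cob_submod (r n.+1) (fun s => @coboundary_act k G A r s n.+1)).

Fact cob_dgd_proof (a : A n) : cob_submod (dgd A n a).
Proof. by exists a. Qed.
Definition cob_dgd (a : A n) : cob_kGmod := mksub (cob_dgd_proof a).
Fact cob_dgd_linear : linear cob_dgd.
Proof. by move=> c a b; apply: subm_inj; rewrite subm_valP !mksubE linearP. Qed.
HB.instance Definition _ :=
  GRing.isLinear.Build k (A n) cob_kGmod _ cob_dgd cob_dgd_linear.
Fact cob_dgd_equiv s (a : A n) : cob_dgd (r n s a) = kG_act cob_kGmod s (cob_dgd a).
Proof. by apply: subm_inj; rewrite !mksubE da_actd. Qed.

Lemma invariant_coboundary (a : A n.+1) :
  is_invariant (r n.+1) a -> is_coboundary a ->
  exists2 b, is_invariant (r n) b & a = dgd A n b.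
Proof.
move=> a_inv a_cob.
pose g := @KGHom k G (KGMod (r n)) cob_kGmod (cob_dgd : {linear _ -> _}) cob_dgd_equiv.
have g_surj w : exists b, g b = w.
  by have [b wb] := subm_in w; exists b; apply: subm_inj.
have [|b b_inv gb] := @invariant_lift _ _ g g_surj (mksub (S := cob_submod) a_cob).
  by move=> s; apply: subm_inj; rewrite !mksubE a_inv.
by exists b => //; rewrite -[LHS](mksubE (S := cob_submod) a_cob) -gb.
Qed.
End CoboundaryLift.

Lemma invariant_cocycle n (x : coh A n) : is_invariant (coh_act r n) x ->
  exists2 a : subm (cocycles A n), is_invariant (r n) (subm_val a) & hcls a = x.
Proof.
move=> x_inv.
pose M := KGMod (@sub_act k G _ (cocycles A n) (r n) (fun s => @cocycle_act k G A r s n)).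
have g_equiv s (a : M) : cls (coboundaries A n) (kG_act M s a) =
    kG_act (KGMod (coh_act r n)) s (cls (coboundaries A n) a).
  by rewrite /= [RHS](coh_act_funE r s a).
pose g := @KGHom k G M (KGMod (coh_act r n)) (cls (coboundaries A n)) g_equiv.
have g_surj w : exists a, g a = w by exists (rep w); apply: repK.
have [a a_inv ga] := @invariant_lift _ _ g g_surj x x_inv.
by exists a => // s; rewrite -[in RHS](a_inv s).
Qed.

Definition forget_cocycle n (a : subm (cocycles (inv_dga r) n)) : subm (cocycles A n) :=
  mksub (S := cocycles A n) (congr1 (@subm_val _ _ _) (subm_in a)).

(** The comparison map sends the class of an invariant cocycle to its class among
all cocycles; invariant_coboundary gives injectivity and invariant_cocycle
surjectivity. *)
Fact inv_class_proof n (a : subm (cocycles (inv_dga r) n)) :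
  invariants (coh_act r n) (hcls (forget_cocycle a)).
Proof.
move=> s; rewrite /= coh_act_funE; congr hcls; apply: subm_inj.
by rewrite !mksubE (subm_in (subm_val a) s).
Qed.

Definition inv_class n (a : subm (cocycles (inv_dga r) n)) :
  subm (invariants (coh_act r n)) := mksub (inv_class_proof a).

Fact inv_class_linear n : linear (@inv_class n).
Proof.
move=> c a b; apply: subm_inj; rewrite subm_valP !mksubE -hclsP_lin.
by congr hcls; apply: subm_inj; rewrite subm_valP !mksubE !subm_valP.
Qed.
HB.instance Definition _ n :=
  GRing.isLinear.Build k (subm (cocycles (inv_dga r) n))
    (subm (invariants (coh_act r n))) _ (@inv_class n) (@inv_class_linear n).

Theorem exact_coh_inv : galg_isom (cohomology (inv_dga r)) (inv_galg (coh_action r)).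
Proof.
apply: (@cohomology_isom _ (inv_dga r) (inv_galg (coh_action r))
  (fun n => @inv_class n : {linear _ -> _})) => /=.
- move=> n a; split=> [a_cob|a0].
    apply: subm_inj; rewrite mksubE; apply/hcls_eq0.
    case: n a a_cob => [|n] a /=; first by move=> ->.
    by case=> b ->; exists (subm_val b).
  have /hcls_eq0 : hcls (forget_cocycle a) = 0.
    by rewrite -[LHS](mksubE (inv_class_proof a)) [mksub _]a0.
  case: n a {a0} => [|n] a /=; first by move=> a0; apply: subm_inj.
  move=> /(@invariant_coboundary n _ (subm_in (subm_val a)))[b b_inv ab].
  by exists (mksub (S := invariants (r n)) b_inv); apply: subm_inj.
- move=> n b; have [a a_inv ab] := invariant_cocycle (subm_in b).
  pose a' : inv_dga r n := mksub (S := invariants (r n)) a_inv.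
  have a0 : cocycles (inv_dga r) n a' by apply: subm_inj; apply: (subm_in a).
  by exists (mksub a0); apply: subm_inj; rewrite -ab mksubE; congr hcls; apply: subm_inj.
- by apply: subm_inj; congr hcls; apply: subm_inj.
- move=> m n a b; apply: subm_inj; rewrite /= hmulE; congr hcls.
  exact: subm_inj.
Qed.
End ExactInvariants.

(** * Partial cochains with a fixed target *)
(** Inductions over chains remove the leftmost entry, so they run over the
functions kfun z y: the target z of the values stays fixed while the target y of
the chain varies.  A cochain phi is the family of the phi z : kfun z z. *)
Section KFunctions.
Variables (k : fieldType) (B : kcat k).

Lemma kfun_ext n (z y : B) (psi chi : kfun z y n) :
  (forall x c, psi x c = chi x c) -> psi = chi.
Proof.
move=> e; apply: functional_extensionality_dep => x.
by apply: functional_extensionality_dep => c.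
Qed.

Definition kmulti n (z y : B) (psi : kfun z y n) : Prop :=
  forall x, multilinear (psi x).

Definition klin n (z y : B) (a : k) (psi chi : kfun z y n) : kfun z y n :=
  fun x c => a *: psi x c + chi x c.

Definition kcomp n (z v y : B) (f : hom z v) (psi : kfun v y n) : kfun z y n :=
  fun x c => comp f (psi x c).

Lemma kmulti_kcons n (z y w : B) (psi : kfun z y n.+1) (f : hom y w) :
  kmulti psi -> kmulti (kcons psi f).
Proof. by move=> h x; have [_] := h x; apply. Qed.

Lemma kmulti_rmod n (z y w : B) (psi : kfun z y n) (f : hom y w) :
  kmulti psi -> kmulti (rmod psi f).
Proof. by move=> h x; apply: rmod_multi. Qed.

Lemma kmulti_kcomp n (z v y : B) (f : hom z v) (psi : kfun v y n) :
  kmulti psi -> kmulti (kcomp f psi).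
Proof.
move=> h x; apply: (multilinear_lin (F := comp f)) (h x).
by move=> a g g'; apply: compPr.
Qed.

Lemma kmulti_klin n (z y : B) a (psi chi : kfun z y n) :
  kmulti psi -> kmulti chi -> kmulti (klin a psi chi).
Proof. by move=> h h' x; apply: multilinearP. Qed.

Lemma kcons_lin n (z y w : B) (psi : kfun z y n.+1) a (f g : hom y w) :
  kmulti psi -> kcons psi (a *: f + g) = klin a (kcons psi f) (kcons psi g).
Proof. by move=> h; apply: kfun_ext => x c; have [+ _] := h x; apply. Qed.

Lemma kcons0 n (z y w : B) (psi : kfun z y n.+1) :
  kmulti psi -> kcons psi (0 : hom y w) = fun x c => 0.
Proof.
by move=> h; apply: kfun_ext => x c; have [+ _] := h x; move=> /(_ w c)/linear_0.
Qed.

Lemma rmod_idm n (z y : B) (psi : kfun z y n) : rmod psi (idm y) = psi.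
Proof.
apply: kfun_ext => x; case: n psi => [|n] psi c; first by case: x / c; apply: compm1.
by elim/chain_case: c => w f p; rewrite /= comp1m.
Qed.

Lemma rmod_kcomp n (z v y w : B) (g : hom z v) (psi : kfun v y n) (f : hom y w) :
  rmod (kcomp g psi) f = kcomp g (rmod psi f).
Proof.
apply: kfun_ext => x; case: n psi => [|n] psi c; first by rewrite /= /kcomp /= compA.
by elim/chain_case: c => u h p.
Qed.

Variable S : forall y x : B, hom y x -> Prop.

(** Relative cochains: a morphism of S can be moved across each tensor sign,
psi (.., f, g h, ..) = psi (.., f g, h, ..) for g in S; at the right end, where
no h is left, psi (.., f) g = psi (.., f g). *)
Fixpoint kbalanced n (z y : B) : kfun z y n -> Prop :=
  match n return kfun z y n -> Prop with
  | 0%N => fun _ => True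
  | n'.+1 => fun psi => forall w (f : hom y w),
      (forall t (g : hom w t), S g -> rmod (kcons psi f) g = kcons psi (comp f g)) /\
      kbalanced (kcons psi f)
  end.

Lemma kbalanced0 n (z y : B) : kbalanced (fun x (_ : chain n y x) => 0 : hom z x).
Proof.
elim: n y => [//|n IH] y w f; split; last exact: IH.
move=> t g _; apply: kfun_ext => x; case: n {IH} => [|n] p; first exact: comp0m.
by elim/chain_case: p.
Qed.

Lemma kbalanced_lin n (z y : B) a (psi chi : kfun z y n) :
  kbalanced psi -> kbalanced chi -> kbalanced (klin a psi chi).
Proof.
elim: n y psi chi => [//|n IH] y psi chi h h' w f.
have [h1 h2] := h w f; have [h1' h2'] := h' w f; split; last exact: IH.
move=> t g Sg; apply: kfun_ext => x p.
rewrite -[kcons (klin _ _ _) f]/(klin a (kcons psi f) (kcons chi f)).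
by rewrite rmodP h1 // h1'.
Qed.

Lemma kbalanced_kcomp n (z v y : B) (e : hom z v) (psi : kfun v y n) :
  kbalanced psi -> kbalanced (kcomp e psi).
Proof.
elim: n y psi => [//|n IH] y psi h w f; have [h1 h2] := h w f.
split; last exact: (IH w (kcons psi f)).
move=> t g Sg; rewrite -[kcons (kcomp _ _) f]/(kcomp e (kcons psi f)).
by rewrite rmod_kcomp h1.
Qed.
End KFunctions.

(** * Conjugation is homotopic to the identity *)
Lemma sign_cancel (k : fieldType) (V : lmodType k) (s : k) (a b d e r m : V) :
  s * s = 1 ->
  s *: (s *: a + b) + (s *: d + e) +
    (- s *: (- s *: r + (s *: a + d)) + (- s *: (s *: r + b) + m)) = e + m.
Proof.
move=> ss; rewrite !scalerDr !scalerA mulrNN !mulNr ss !scaleNr !scale1r !addrA.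
rewrite (ACl ((1 * 6) * (2 * 9) * (3 * 7) * (5 * 8) * 4 * 10)%AC) /=.
by rewrite !subrr !add0r.
Qed.

(** For u_x : tau x -> x and v_x : x -> tau x with u v = 1, the map
conj_hom : f |-> v f u respects composition, and both u and v commute with it, as
natural transformations do. *)
Section Conjugation.
Variables (k : fieldType) (B : kcat k) (tau : B -> B).
Variables (u : forall x, hom x (tau x)) (v : forall x, hom (tau x) x).
Hypothesis uvK : forall x, comp (u x) (v x) = idm x.

Definition conj_hom (y x : B) (f : hom y x) : hom (tau y) (tau x) :=
  comp (v y) (comp f (u x)).

Lemma conj_hom_lin (y x : B) a (f g : hom y x) :
  conj_hom (a *: f + g) = a *: conj_hom f + conj_hom g.
Proof. by rewrite /conj_hom compPl compPr. Qed.

Lemma conj_hom_comp (z y x : B) (f : hom z y) (g : hom y x) :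
  conj_hom (comp f g) = comp (conj_hom f) (conj_hom g).
Proof.
rewrite /conj_hom -!compA; congr comp; congr comp.
by rewrite !compA uvK comp1m.
Qed.

Lemma conj_hom_natl (y x : B) (f : hom y x) : comp (conj_hom f) (v x) = comp (v y) f.
Proof. by rewrite /conj_hom -!compA uvK compm1. Qed.

Lemma conj_hom_natr (y x : B) (f : hom y x) : comp (u y) (conj_hom f) = comp f (u x).
Proof. by rewrite /conj_hom compA uvK comp1m. Qed.

(** psi (N f_n, ..., N f_1) v, with N = conj_hom. *)
Fixpoint kconj n (z y : B) : kfun z (tau y) n -> kfun z y n :=
  match n return kfun z (tau y) n -> kfun z y n with
  | 0%N => fun psi x e => hcast erefl e (comp (psi (tau y) erefl) (v y))
  | n'.+1 => fun psi x c =>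
      let: existT w (f, p) := c in kconj (kcons psi (conj_hom f)) p
  end.

(** The sum over i of (-1)^i psi (N f_n, ..., N f_(i+1), v, f_i, ..., f_1): the
usual homotopy of a natural transformation v from the identity to N = conj_hom. *)
Fixpoint khtpy n (z y : B) : kfun z (tau y) n.+1 -> kfun z y n :=
  match n return kfun z (tau y) n.+1 -> kfun z y n with
  | 0%N => fun psi => kcons psi (v y)
  | n'.+1 => fun psi x c => (-1) ^+ n'.+1 *: kcons psi (v y) c +
      let: existT w (f, p) := c in khtpy (kcons psi (conj_hom f)) p
  end.

Lemma kcons_kconj n (z y w : B) (psi : kfun z (tau y) n.+1) (f : hom y w) :
  kcons (kconj psi) f = kconj (kcons psi (conj_hom f)).
Proof. by []. Qed.

Lemma khtpy_cons n (z y w x : B) (psi : kfun z (tau y) n.+2) (f : hom y w)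
    (p : chain n w x) :
  khtpy psi (ccons f p) =
    (-1) ^+ n.+1 *: psi x (ccons (v y) (ccons f p)) +
    khtpy (kcons psi (conj_hom f)) p.
Proof. by []. Qed.

Lemma kcons_khtpy n (z y w : B) (psi : kfun z (tau y) n.+2) (f : hom y w) :
  kcons (khtpy psi) f =
    klin ((-1) ^+ n.+1) (kcons (kcons psi (v y)) f) (khtpy (kcons psi (conj_hom f))).
Proof. by []. Qed.

Lemma kconj_lin n (z y : B) a (psi chi : kfun z (tau y) n) :
  kconj (klin a psi chi) = klin a (kconj psi) (kconj chi).
Proof.
elim: n y psi chi => [|n IH] y psi chi; apply: kfun_ext => x c.
  by case: x / c; apply: compPl.
elim/chain_case: c => w f p.
exact: (congr1 (fun F : kfun z w n => F x p) (IH w _ _)).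
Qed.

Lemma khtpy_lin n (z y : B) a (psi chi : kfun z (tau y) n.+1) :
  khtpy (klin a psi chi) = klin a (khtpy psi) (khtpy chi).
Proof.
elim: n y psi chi => [|n IH] y psi chi; first by [].
apply: kfun_ext => x; elim/chain_case=> w f p.
have E := congr1 (fun F : kfun z w n => F x p)
  (IH w (kcons psi (conj_hom f)) (kcons chi (conj_hom f))).
rewrite /klin khtpy_cons [X in _ + X = _]E !khtpy_cons /klin.
rewrite !scalerDr !scalerA [a * _]mulrC -!addrA.
by congr (_ + _); rewrite addrCA.
Qed.

Lemma kmulti_kconj n (z y : B) (psi : kfun z (tau y) n) :
  kmulti psi -> kmulti (kconj psi).
Proof.
elim: n y psi => [//|n IH] y psi h x; split=> [w p|w f]; last first.
  exact: (IH w (kcons psi (conj_hom f)) (kmulti_kcons _ h)).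
move=> a f g; rewrite -![kconj _ _]/(kconj (kcons psi _) p).
by rewrite conj_hom_lin kcons_lin // kconj_lin.
Qed.

Lemma kmulti_khtpy n (z y : B) (psi : kfun z (tau y) n.+1) :
  kmulti psi -> kmulti (khtpy psi).
Proof.
elim: n y psi => [//|n IH] y psi h x; split=> [w p|w f]; last first.
  have h1 := kmulti_kcons f (kmulti_kcons (v y) h).
  have h2 := IH w (kcons psi (conj_hom f)) (kmulti_kcons _ h).
  exact: (kmulti_klin ((-1) ^+ n.+1) h1 h2 x).
move=> a f g; rewrite !khtpy_cons conj_hom_lin kcons_lin // khtpy_lin /klin.
have E := congr1 (fun F : kfun z w n => F x p)
  (kcons_lin a f g (kmulti_kcons (v y) h)).
rewrite [psi _ _]E /klin !scalerDr !scalerA [a * _]mulrC -!addrA.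
by congr (_ + _); rewrite addrCA.
Qed.

Lemma kconj_kcomp n (z t y : B) (g : hom z t) (psi : kfun t (tau y) n) :
  kconj (kcomp g psi) = kcomp g (kconj psi).
Proof.
elim: n y psi => [|n IH] y psi; apply: kfun_ext => x c.
  by case: x / c; rewrite /kcomp /= compA.
elim/chain_case: c => w f p.
exact: (congr1 (fun F : kfun z w n => F x p) (IH w (kcons psi (conj_hom f)))).
Qed.

Lemma khtpy_kcomp n (z t y : B) (g : hom z t) (psi : kfun t (tau y) n.+1) :
  khtpy (kcomp g psi) = kcomp g (khtpy psi).
Proof.
elim: n y psi => [//|n IH] y psi; apply: kfun_ext => x; elim/chain_case=> w f p.
have E := congr1 (fun F : kfun z w n => F x p) (IH w (kcons psi (conj_hom f))).
by rewrite /kcomp khtpy_cons [X in _ + X = _]E khtpy_cons /kcomp compDr compZr.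
Qed.

Lemma kconj_rmod n (z y w : B) (psi : kfun z (tau y) n) (f : hom y w) :
  kconj (rmod psi (conj_hom f)) = rmod (kconj psi) f.
Proof.
apply: kfun_ext => x; case: n psi => [|n] psi c.
  by case: x / c; rewrite /= -compA conj_hom_natl compA.
elim/chain_case: c => t g q.
by rewrite /= conj_hom_comp.
Qed.

(** On partial cochains the homotopy formula has the single term kconj psi.  Its
other term, the identity, appears in cconj_htpy0 and cconj_htpyS, from the
leftmost summand f_(n+1) phi (f_n, ..., f_1) of the coboundary, which dk does
not contain: there f_(n+1) is replaced with v, and u v = 1. *)
Lemma dk_khtpy n (z y x : B) (psi : kfun z (tau y) n.+1) (c : chain n.+1 y x) :
  dk (khtpy psi) c + khtpy (dk psi) c = kconj psi c.
Proof.
(* Induction applies to kcons psi (conj_hom f), where v comes after the first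
   place; the terms with v in the first place, and those that multiply the first
   two entries, cancel by sign_cancel. *)
elim: n y psi c => [|n IH] y psi; elim/chain_case=> w f p.
  rewrite khtpy_cons [X in X + _]/= [X in _ *: X]/= expr1 scaleN1r.
  case: x / p => /=; rewrite /kcons /= expr1 scaleN1r conj_hom_natl.
  rewrite !scaleN1r !opprD !opprK !addrA.
  by rewrite (ACl ((1 * 3) * (2 * 4) * 5)%AC) /= !subrr !add0r.
rewrite dk_cons kcons_khtpy dkP khtpy_cons dk_cons.
have -> : kcons (dk psi) (conj_hom f) =
  klin ((-1) ^+ n.+2) (rmod psi (conj_hom f)) (dk (kcons psi (conj_hom f))) by [].
rewrite khtpy_lin /klin (dk_cons (kcons psi (v y))).
rewrite -[RHS]/(kconj (kcons psi (conj_hom f)) p) -(IH w (kcons psi (conj_hom f))).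
elim/chain_case: p => t g q.
have -> : rmod (khtpy psi) f (ccons g q) = khtpy psi (ccons (comp f g) q) by [].
rewrite !khtpy_cons.
have -> : rmod psi (conj_hom f) (ccons (v w) (ccons g q)) =
  psi x (ccons (comp (v y) f) (ccons g q)) by rewrite -conj_hom_natl.
have -> : kcons (rmod psi (conj_hom f)) (conj_hom g) = kcons psi (conj_hom (comp f g)).
  by apply: kfun_ext => x' c; rewrite conj_hom_comp.
rewrite [(-1) ^+ n.+2]exprS mulN1r; apply: sign_cancel.
by rewrite -exprMn mulrNN mulr1 expr1n.
Qed.

Lemma khtpy_dk0 (z y x : B) (psi : kfun z (tau y) 0) (c : chain 0 y x) :
  khtpy (dk psi) c = kconj psi c.
Proof. by case: x / c. Qed.

(** u_z phi (N f_n, ..., N f_1) v_x, and the matching homotopy. *)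
Definition cconj_fun n (phi : cfun B n) : cfun B n :=
  fun z => kcomp (u z) (kconj (phi (tau z))).

Definition chtpy_fun n (phi : cfun B n.+1) : cfun B n :=
  fun z => kcomp (u z) (khtpy (phi (tau z))).

Fact cconj_multi n (phi : cochain B n) : is_cochain (cconj_fun (cval phi)).
Proof. by move=> z; apply/kmulti_kcomp/kmulti_kconj => x; apply: (subm_in phi). Qed.

Fact chtpy_multi n (phi : cochain B n.+1) : is_cochain (chtpy_fun (cval phi)).
Proof. by move=> z; apply/kmulti_kcomp/kmulti_khtpy => x; apply: (subm_in phi). Qed.

Definition cconj n (phi : cochain B n) : cochain B n :=
  mksub (S := cochain_submod B n) (@cconj_multi n phi).

Definition chtpy n (phi : cochain B n.+1) : cochain B n :=
  mksub (S := cochain_submod B n) (@chtpy_multi n phi).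

Fact chtpy_linear n : linear (@chtpy n).
Proof.
move=> a phi psi; apply: cochain_inj => z x c; rewrite cvalP.
have E : @cval _ _ _ (a *: phi + psi) (tau z) =
    klin a (@cval _ _ _ phi (tau z)) (@cval _ _ _ psi (tau z)).
  by apply: kfun_ext => *; apply: cvalP.
rewrite [LHS]/(comp (u z) (khtpy _ c)) E khtpy_lin.
exact: compPr.
Qed.

Lemma cval_cobd_kfun n (phi : cochain B n) (z : B) :
  @cval _ _ _ (cobd phi) z =
    klin ((-1) ^+ n.+1) (fun x c => head_term (cval phi) c) (dk (@cval _ _ _ phi z)).
Proof.
by apply: kfun_ext => x; elim/chain_case=> y f p; rewrite cval_cobd cobdE.
Qed.

(** Splitting the coboundary into its leftmost summand and dk, on which the
homotopy acts by dk_khtpy. *)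
Lemma cval_chtpy_cobd n (phi : cochain B n) (z x : B) (c : chain n z x) :
  cval (chtpy (cobd phi)) c =
    (-1) ^+ n.+1 *:
      comp (u z) (khtpy (fun x c => head_term (cval phi) (z := tau z) (x := x) c) c) +
    comp (u z) (khtpy (dk (@cval _ _ _ phi (tau z))) c).
Proof.
rewrite -[LHS]/(comp (u z) (khtpy (@cval _ _ _ (cobd phi) (tau z)) c)).
by rewrite cval_cobd_kfun khtpy_lin -compZr -compDr.
Qed.

Lemma cconj_htpy0 (phi : cochain B 0) : chtpy (cobd phi) = cconj phi - phi.
Proof.
apply: cochain_inj => z x c; rewrite cval_chtpy_cobd khtpy_dk0 addrC expr1 scaleN1r.
rewrite cvalD -[- phi]scaleN1r cvalZ scaleN1r; congr (_ - _).
by rewrite /= /kcons /= compA uvK comp1m.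
Qed.

Lemma cconj_htpyS n (phi : cochain B n.+1) :
  cobd (chtpy phi) + chtpy (cobd phi) = cconj phi - phi.
Proof.
apply: cochain_inj => z x c; rewrite cvalD cval_chtpy_cobd cval_cobd.
rewrite -(scaleN1r phi) addrC cvalD cvalZ scaleN1r.
elim/chain_case: c => y f p; rewrite cobdE.
rewrite -[X in _ = X + _]/(comp (u z) (kconj (@cval _ _ _ phi (tau z)) (ccons f p))).
rewrite -dk_khtpy compDr [@cval _ _ _ (chtpy phi) z]/=.
rewrite [dk (@cval _ _ _ (chtpy phi) z) _](dk_comp (u z) (khtpy (@cval _ _ _ phi (tau z)))).
rewrite khtpy_cons.
have -> : kcons (fun x c => head_term (cval phi) (x := x) c) (conj_hom f) =
  kcomp (conj_hom f) (@cval _ _ _ phi (tau y)) by [].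
rewrite khtpy_kcomp compDr compZr -[head_term _ _]/(comp (v z) (cval phi (ccons f p))).
rewrite /kcomp [comp (u z) (comp (v z) _)]compA uvK comp1m.
rewrite [comp (u z) (comp (conj_hom f) _)]compA conj_hom_natr -compA.
rewrite -[comp (u y) _]/(cval (chtpy phi) p).
rewrite [(-1) ^+ n.+2]exprS mulN1r !scalerDr scalerA mulNr -exprMn mulrNN mulr1 expr1n.
rewrite !scaleNr scale1r !addrA.
by rewrite (ACl ((2 * 4) * 5 * 3 * 1)%AC) /= addNr add0r.
Qed.

(** Conjugation fixes the relative cochains: in u (v f_n u) (v f_(n-1) u) ... each
u moves one place to the right and cancels the next v. *)
Lemma kconj_rmod_u (S : forall y x, hom y x -> Prop) n (z y : B) (psi : kfun z y n) :
  (forall x, S x (tau x) (u x)) -> kbalanced S psi -> kconj (rmod psi (u y)) = psi.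
Proof.
move=> Su; elim: n y psi => [|n IH] y psi hpsi; apply: kfun_ext => x c.
  by case: x / c; rewrite /= -compA uvK compm1.
elim/chain_case: c => w f p; have [hf1 hf2] := hpsi w f.
have E : kcons (rmod psi (u y)) (conj_hom f) = rmod (kcons psi f) (u w).
  by rewrite hf1 // -conj_hom_natr.
rewrite -[LHS]/(kconj (kcons (rmod psi (u y)) (conj_hom f)) p) E.
exact: (congr1 (fun F : kfun z w n => F x p) (IH w _ hf2)).
Qed.

(** Moving g across a tensor sign in kconj psi moves conj_hom g in psi.  This is
used with a class S' of identities, to which every psi is relative. *)
Lemma kbalanced_kconj (S S' : forall y x, hom y x -> Prop) n (z y : B)
    (psi : kfun z (tau y) n) :
  (forall y x (f : hom y x), S y x f -> S' _ _ (conj_hom f)) ->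
  kbalanced S' psi -> kbalanced S (kconj psi).
Proof.
move=> hS; elim: n y psi => [//|n IH] y psi h w f.
have [h1 h2] := h _ (conj_hom f); split; last exact: IH.
move=> t g Sg; rewrite kcons_kconj -kconj_rmod h1; last exact: hS.
by rewrite kcons_kconj conj_hom_comp.
Qed.
End Conjugation.

(** * Homogeneous morphisms and shifts in the skew category *)
Section HomogeneousMorphisms.
Variables (k : fieldType) (G : groupType) (C : gkcat k G).
Local Notation shom := (@hom k (skew_cat C)).

(** The source of f is a free variable y', tied to s x by an equation only, so that
an equality such as t (s x) = (t s) x is absorbed by e and no cast of f is
needed. *)
Definition hmor (s : G) (y y' x : C) (e : y' = oact s x) (f : hom y y') : shom y x :=
  skew_of (hcast erefl e f).

Lemma hmor_eq s s' (y y' y'' x : C) (e : y' = oact s x) (e' : y'' = oact s' x)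
    (f : hom y y') (f' : hom y y'') :
  s = s' -> tot f = tot f' -> hmor e f = hmor e' f'.
Proof. by move=> es ef; apply: skew_of_eq => //; rewrite !tot_hcast. Qed.

Lemma hmor_linear s (y y' x : C) (e : y' = oact s x) : linear (@hmor s y y' x e).
Proof. by move=> a f g; rewrite /hmor hcast_linear; apply: skew_of_linear. Qed.

Lemma hmor_inj s (y y' x : C) (e : y' = oact s x) : injective (@hmor s y y' x e).
Proof.
move=> f g /(congr1 (fun h => dval h s)).
by rewrite /hmor !dinj_in => /(congr1 (@tot _ _ _ _)); rewrite !tot_hcast => /tot_inj.
Qed.

Lemma shom_ind (y x : C) (P : shom y x -> Prop) :
  P 0 -> (forall f g, P f -> P g -> P (f + g)) ->
  (forall s y' (e : y' = oact s x) (f : hom y y'), P (hmor e f)) -> forall f, P f.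
Proof. by move=> h0 hD hh; apply: skew_ind => // s f; apply: (hh s _ erefl f). Qed.

Lemma hmor_comp t s (z z' y y' x : C) (eg : z' = oact t y) (g : hom z z')
    (ef : y' = oact s x) (f : hom y y') (e : oact t y' = oact (t * s)%g x) :
  comp (hmor eg g) (hmor ef f) =
    hmor e (comp g (hcast (esym eg) erefl (mact t _ _ f))).
Proof.
rewrite [LHS]skew_compof; apply: skew_of_eq => //; rewrite !tot_hcast.
apply: tot_comp; first exact: tot_hcast.
by rewrite tot_hcast; apply: tot_mact; rewrite tot_hcast.
Qed.

Lemma hmor_gr s (y y' x : C) (e : y' = oact s x) (f : hom y y') :
  @gr k G (skew_category C) s y x (hmor e f).
Proof. by exists (hcast erefl e f). Qed.

Lemma gr_hmor s (y x : C) (f : shom y x) :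
  @gr k G (skew_category C) s y x f -> exists f0 : hom y (oact s x), f = hmor erefl f0.
Proof. by case=> f0 ->; exists f0. Qed.

(** The identity of s x, as an isomorphism of degree s from x to y = s x. *)
Definition shift (s : G) (y x : C) (e : y = oact s x) : shom y x := hmor e (idm y).

Definition is_shift (y x : skew_cat C) (f : shom y x) : Prop :=
  exists s (e : y = oact s x), f = shift e.

(** The inclusion functor of C as the part of degree 1. *)
Definition incl1 (y x : C) (f : hom y x) : shom y x := hmor (esym (oact1 x)) f.

Lemma shift1 s (y : C) (e : y = oact s y) : s = 1%g -> shift e = idm (y : skew_cat C).
Proof. by move=> s1; apply: skew_of_eq; rewrite ?s1 // !tot_hcast. Qed.

Lemma shift_comp t s (z y x : C) (ez : z = oact t y) (ey : y = oact s x)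
    (e : z = oact (t * s)%g x) :
  comp (shift ez) (shift ey) = shift e.
Proof.
have e' : oact t y = oact (t * s)%g x by rewrite -e ez.
rewrite /shift (hmor_comp _ _ _ _ e'); apply: hmor_eq => //.
by rewrite comp1m tot_hcast mact_id -ez.
Qed.

(** The skew category is generated by C and the shifts, with the relation
shift_incl1. *)
Lemma hmor_shift s (y y' x : C) (e : y' = oact s x) (f : hom y y') :
  hmor e f = comp (incl1 f) (shift e).
Proof.
have e' : oact 1 y' = oact (1 * s)%g x by rewrite mul1g oact1.
rewrite /shift (hmor_comp _ _ _ _ e'); apply: hmor_eq; first by rewrite mul1g.
rewrite mact_id -[in LHS](compm1 f); apply: tot_comp => //.
by rewrite tot_hcast oact1.
Qed.

Lemma shift_hmor t s (z y y' x : C) (ez : z = oact t y) (ef : y' = oact s x)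
    (f : hom y y') (e : oact t y' = oact (t * s)%g x) :
  comp (shift ez) (hmor ef f) = hmor e (hcast (esym ez) erefl (mact t _ _ f)).
Proof. by rewrite (hmor_comp _ _ _ _ e) comp1m. Qed.

Lemma shift_incl1 s (y x : C) (f : hom y x) :
  comp (shift (erefl (oact s y))) (incl1 f) =
    comp (incl1 (mact s _ _ f)) (shift (erefl (oact s x))).
Proof.
have e : oact s x = oact (s * 1)%g x by rewrite mulg1.
rewrite (shift_hmor _ _ _ e) -hmor_shift; apply: hmor_eq => //.
by rewrite mulg1.
Qed.

Lemma incl1_hmor s (z y y' x : C) (g : hom z y) (e : y' = oact s x) (f : hom y y') :
  comp (incl1 g) (hmor e f) = hmor e (comp g f).
Proof.
have e' : oact 1 y' = oact (1 * s)%g x by rewrite oact1 mul1g.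
rewrite (hmor_comp _ _ _ _ e'); apply: hmor_eq; first exact: mul1g.
by apply: tot_comp => //; rewrite tot_hcast tot_mact1.
Qed.

End HomogeneousMorphisms.

(** * Extension of partial cochains to the skew category *)
Section SkewExtension.
Variables (k : fieldType) (G : groupType) (C : gkcat k G).
Local Notation shom := (@hom k (skew_cat C)).
Local Notation skfun := (@kfun k (skew_cat C)).
Local Notation schain := (@chain k (skew_cat C)).

Definition tact (t : G) (y' y x : C) (e : y' = oact t y) (f : hom y x) : hom y' (oact t x) :=
  hcast (esym e) erefl (mact t _ _ f).

Lemma tact_linear t (y' y x : C) (e : y' = oact t y) : linear (@tact t y' y x e).
Proof. by move=> a f g; rewrite /tact linearP hcast_linear. Qed.

(** The twisted value psi (t f_n, t s_n f_(n-1), ...), placed in degree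
t s_n ... s_1, for f_i of degree s_i; it is extended by additivity, one entry at
a time.  The accumulated degree t and the object y' = t y are parameters because
the recursion replaces t with t s_n. *)
Fixpoint kskew n (t : G) (z y' y : C) (e : y' = oact t y) : kfun z y' n -> skfun z y n :=
  match n return kfun z y' n -> skfun z y n with
  | 0%N => fun psi x eyx =>
      hmor (etrans e (congr1 (oact t) eyx)) (psi y' erefl)
  | n'.+1 => fun psi x c =>
      let: existT w (f, p) := c in
      dlift (fun s (fs : hom (y : C) (oact s w)) =>
        kskew (esym (oactM t s w)) (kcons psi (tact e fs)) p) f
  end.

Lemma kskew_cons n t (z y' y w x : C) (e : y' = oact t y) (psi : kfun z y' n.+1)
    (f : shom y w) (p : schain n w x) :
  kskew e psi (ccons f p) =
    dlift (fun s (fs : hom (y : C) (oact s w)) =>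
        kskew (esym (oactM t s w)) (kcons psi (tact e fs)) p) f.
Proof. by []. Qed.

Lemma dlift0 (I : choiceType) (V : I -> lmodType k) (W : lmodType k) (f : dsum V) :
  dlift (fun i (_ : V i) => 0 : W) f = 0.
Proof. by rewrite (@dliftE _ _ _ _ _ _ (dsupp f)) // big1. Qed.

Lemma eq_dlift (I : choiceType) (V : I -> lmodType k) (W : lmodType k)
    (L L' : forall i, V i -> W) (f : dsum V) :
  (forall i v, L i v = L' i v) -> dlift L f = dlift L' f.
Proof.
move=> e; congr (dlift _ f); apply: functional_extensionality_dep => i.
exact: funext.
Qed.

Lemma kskew0 n t (z y' y : C) (e : y' = oact t y) :
  kskew e (fun x (_ : chain n y' x) => 0 : hom z x) =
    fun x (_ : schain n y x) => 0 : shom z x.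
Proof.
elim: n t y' y e => [|n IH] t y' y e; apply: kfun_ext => x.
  by move=> c /=; rewrite (linear_0 (@hmor_linear _ _ _ _ _ _ _ _)).
elim/chain_case=> w f p; rewrite kskew_cons -[RHS](dlift0 _ f).
apply: eq_dlift => s fs.
exact: (congr1 (fun F : skfun z w n => F x p) (IH (t * s)%g _ w _)).
Qed.

Lemma kskew_kcons0 n t (z y' y w x : C) (e : y' = oact t y) (psi : kfun z y' n.+1)
    (p : schain n w x) s :
  kmulti psi -> kskew (esym (oactM t s w)) (kcons psi (tact e 0)) p = 0.
Proof.
move=> h; rewrite (linear_0 (@tact_linear _ _ _ _ e)) kcons0 //.
exact: (congr1 (fun F : skfun z w n => F x p) (kskew0 n z (esym (oactM t s w)))).
Qed.

Lemma kskew_lin n t (z y' y : C) (e : y' = oact t y) a (psi chi : kfun z y' n) :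
  kmulti psi -> kmulti chi ->
  kskew e (klin a psi chi) = klin a (kskew e psi) (kskew e chi).
Proof.
elim: n t y' y e psi chi => [|n IH] t y' y e psi chi h h'; apply: kfun_ext => x.
  by move=> c; rewrite /klin /= hmor_linear.
elim/chain_case=> w f p; rewrite /klin !kskew_cons -dliftP.
- apply: eq_dlift => s fs.
  rewrite -[kcons _ _]/(klin a (kcons psi (tact e fs)) (kcons chi (tact e fs))).
  by rewrite IH //; apply: kmulti_kcons.
- by move=> s; apply: kskew_kcons0.
- by move=> s; apply: kskew_kcons0.
Qed.

Lemma kskew_linl n t (z y' y w x : C) (e : y' = oact t y) (psi : kfun z y' n.+1)
    (p : schain n w x) :
  kmulti psi -> linear (fun f : shom y w => kskew e psi (ccons f p)).
Proof.
move=> h; apply: dlift_linear => s a f g.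
rewrite tact_linear kcons_lin //.
have E := kskew_lin (esym (oactM t s w)) a (kmulti_kcons (tact e f) h)
  (kmulti_kcons (tact e g) h).
exact: (congr1 (fun F : skfun z w n => F x p) E).
Qed.

(** The transport principle for kskew: equal morphisms whose sources are written
differently, as t (s x) and (t s) x, may be exchanged. *)
Lemma kskew_tot n t t' (z y0 y y' x : C) (e : y = oact t x) (e' : y' = oact t' x)
    (F : forall w, hom y0 w -> kfun z w n) (f : hom y0 y) (f' : hom y0 y') :
  t = t' -> tot f = tot f' -> kskew e (F y f) = kskew e' (F y' f').
Proof.
move=> et ef; have ey : y = y' := congr1 (fun u => (projT1 u).2) ef.
case: y' / ey f' e' ef => f' e' /tot_inj <-; case: t' / et e' => e'.
by rewrite (Prop_irrelevance e e').
Qed.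

Lemma kskew_hmor n t s (z y' y w' w : C) (e : y' = oact t y) (ew : w' = oact s w)
    (e2 : oact t w' = oact (t * s)%g w) (psi : kfun z y' n.+1) (f : hom y w') :
  kmulti psi ->
  kcons (kskew e psi) (hmor ew f) = kskew e2 (kcons psi (tact e f)).
Proof.
move=> h; apply: kfun_ext => x p; rewrite /kcons kskew_cons /hmor dlift_dinj.
  apply: (congr1 (fun F : skfun z w n => F x p)).
  apply: (kskew_tot _ _ (fun w f => kcons psi f)) => //.
  by rewrite !tot_hcast; apply: tot_mact; rewrite tot_hcast.
by move=> r; apply: kskew_kcons0.
Qed.

Lemma kmulti_kskew n t (z y' y : C) (e : y' = oact t y) (psi : kfun z y' n) :
  kmulti psi -> kmulti (kskew e psi).
Proof.
elim: n t y' y e psi => [//|n IH] t y' y e psi h x; split=> [w p|w f].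
  exact: kskew_linl.
elim/shom_ind: f => [|f g hf hg|s w' ew f].
- apply: (eq_multilinear (phi := fun _ => 0)); last exact: multilinear0.
  by move=> p; rewrite (linear_0 (kskew_linl e p h)).
- apply: (eq_multilinear _ (multilinearP 1 hf hg)) => p.
  by have := kskew_linl e p h 1 f g; rewrite !scale1r.
- have e2 : oact t w' = oact (t * s)%g w by rewrite ew oactM.
  apply: (eq_multilinear _ (IH (t * s)%g _ w e2 (kcons psi (tact e f)) _ x)).
    by move=> p; rewrite -(kskew_hmor _ ew).
  exact: kmulti_kcons.
Qed.

Lemma kskew_consD n t (z y' y w x : C) (e : y' = oact t y) (psi : kfun z y' n.+1)
    (p : schain n w x) (f g : shom y w) :
  kmulti psi ->
  kskew e psi (ccons (f + g) p) = kskew e psi (ccons f p) + kskew e psi (ccons g p).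
Proof. by move=> h; have := kskew_linl e p h 1 f g; rewrite !scale1r. Qed.

Lemma kskew_cons0 n t (z y' y w x : C) (e : y' = oact t y) (psi : kfun z y' n.+1)
    (p : schain n w x) :
  kmulti psi -> kskew e psi (ccons (0 : shom y w) p) = 0.
Proof. by move=> h; apply: (linear_0 (kskew_linl e p h)). Qed.

Lemma kskew_hmorE n t s (z y' y w' w x : C) (e : y' = oact t y) (ew : w' = oact s w)
    (e2 : oact t w' = oact (t * s)%g w) (psi : kfun z y' n.+1) (f : hom y w')
    (p : schain n w x) :
  kmulti psi ->
  kskew e psi (ccons (hmor ew f) p) = kskew e2 (kcons psi (tact e f)) p.
Proof. by move=> h; rewrite -(kskew_hmor e ew e2 f h). Qed.

Lemma oact_eqM t s (w' w : C) : w' = oact s w -> oact t w' = oact (t * s)%g w.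
Proof. by move=> ->; rewrite oactM. Qed.

(** Acting with f on the right of the extension twists f in the same way as
inserting it in front does (kskew_hmor).  These two facts give the compatibility
with dk, which is built from rmod and kcons. *)
Lemma kskew_rmod n t s (z y' y w' w : C) (e : y' = oact t y) (ew : w' = oact s w)
    (e2 : oact t w' = oact (t * s)%g w) (psi : kfun z y' n) (f : hom y w') :
  kmulti psi ->
  rmod (kskew e psi) (hmor ew f) = kskew e2 (rmod psi (tact e f)).
Proof.
move=> h; apply: kfun_ext => x; case: n psi h => [|n] psi h c.
  by case: x / c; apply: etrans (hmor_comp _ _ _ _ e2) _; apply: hmor_eq.
elim/chain_case: c => v g q.
rewrite -[LHS]/(kskew e psi (ccons (comp (hmor ew f) g) q)).
have h' := kmulti_rmod (tact e f) h.
elim/shom_ind: g => [|g g' hg hg'|r v' ev g].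
- by rewrite compm0 !kskew_cons0.
- by rewrite compDr !kskew_consD // hg hg'.
have e3 := oact_eqM s ev; have e4 := oact_eqM t e3; have e5 := oact_eqM (t * s) ev.
rewrite (hmor_comp _ _ _ _ e3) (kskew_hmorE _ _ e4) // (kskew_hmorE _ _ e5) //.
rewrite -[kcons (rmod _ _) _]/(kcons psi (comp (tact e f) (tact e2 g))).
apply: (congr1 (fun F : skfun z v n => F x q)).
apply: (kskew_tot _ _ (fun w f => kcons psi f)); first by rewrite mulgA.
rewrite tot_hcast mact_comp; apply: tot_comp; first by rewrite tot_hcast.
rewrite tot_hcast tot_mactM; apply: tot_mact.
by rewrite tot_hcast.
Qed.

Lemma kskew_rmod_shift n t s (z y' y w : C) (e : y' = oact t y) (ew : y = oact s w)
    (e2 : y' = oact (t * s)%g w) (psi : kfun z y' n) :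
  kmulti psi -> rmod (kskew e psi) (shift ew) = kskew e2 psi.
Proof.
move=> h; rewrite (kskew_rmod _ _ (oact_eqM t ew)) // -[in RHS](rmod_idm psi).
apply: (kskew_tot _ _ (fun w f => rmod psi f)) => //.
by rewrite tot_hcast mact_id -e.
Qed.

Lemma kmulti_dk n (D : kcat k) (z y : D) (psi : kfun z y n) : kmulti psi -> kmulti (dk psi).
Proof. by move=> h x; apply: dk_multi. Qed.

Lemma kskew_dk n t (z y' y : C) (e : y' = oact t y) (psi : kfun z y' n) :
  kmulti psi -> kskew e (dk psi) = dk (kskew e psi).
Proof.
elim: n t y' y e psi => [|n IH] t y' y e psi h; apply: kfun_ext => x;
  elim/chain_case=> w f p.
all: have hd := kmulti_dk h.
all: have [hl _] := kmulti_dk (kmulti_kskew e h) x.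
all: elim/shom_ind: f => [|f g hf hg|s w' ew f];
  first by rewrite kskew_cons0 // (linear_0 (hl _ p)).
all: try by have := hl _ p 1 f g; rewrite !scale1r => ->; rewrite kskew_consD // hf hg.
all: have e2 := oact_eqM t ew; rewrite (kskew_hmorE _ _ e2) //.
  rewrite -[RHS]/(rmod (kskew e psi) (hmor ew f) p).
  by rewrite (kskew_rmod _ _ e2).
rewrite dk_cons (kskew_rmod _ _ e2) // (kskew_hmor _ _ e2) // -IH; last exact: kmulti_kcons.
rewrite -[kcons (dk psi) _]/(klin ((-1) ^+ n.+1) (rmod psi (tact e f)) (dk (kcons psi (tact e f)))).
rewrite kskew_lin //; first exact: kmulti_rmod.
by apply: kmulti_dk; apply: kmulti_kcons.
Qed.

Lemma kskew_kcomp n t (z v y' y : C) (g : hom z v) (e : y' = oact t y) (psi : kfun v y' n) :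
  kmulti psi -> kskew e (kcomp g psi) = kcomp (incl1 g) (kskew e psi).
Proof.
elim: n t y' y e psi => [|n IH] t y' y e psi h; apply: kfun_ext => x.
  by case: x /; apply/esym/incl1_hmor.
have h' := kmulti_kcomp g h.
elim/chain_case=> w f p; rewrite /kcomp.
elim/shom_ind: f => [|f f' hf hf'|s w' ew f].
- by rewrite !kskew_cons0 // compm0.
- by rewrite !kskew_consD // compDr hf hf'.
have e2 := oact_eqM t ew; rewrite !(kskew_hmorE _ _ e2) //.
exact: (congr1 (fun F : skfun z w n => F x p) (IH _ _ _ e2 _ (kmulti_kcons _ h))).
Qed.

(** Translating psi by s on C amounts to composing its extension with a shift. *)
Lemma kskew_shift n s t (z y' y : C) (e : y' = oact t y)
    (e2 : oact s y' = oact (s * t)%g y) (psi : kfun z y' n)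
    (chi : kfun (oact s z) (oact s y') n) :
  kmulti psi -> kmulti chi -> kequiv psi chi ->
  kcomp (shift (erefl (oact s z))) (kskew e psi) = kskew e2 chi.
Proof.
elim: n t y' y e e2 psi chi => [|n IH] t y' y e e2 psi chi h h' hpc; apply: kfun_ext => x.
  case: x /; apply: etrans (shift_hmor _ _ _ e2) _; apply: hmor_eq => //.
  by rewrite tot_hcast -hpc.
elim/chain_case=> w f p; rewrite /kcomp.
elim/shom_ind: f => [|f f' hf hf'|r w' ew f].
- by rewrite !kskew_cons0 // compm0.
- by rewrite !kskew_consD // compDr hf hf'.
have e3 := oact_eqM t ew; have e4 := oact_eqM s e3; have e5 := oact_eqM (s * t) ew.
rewrite (kskew_hmorE _ _ e3) // (kskew_hmorE _ _ e5) //.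
have E := IH _ _ _ e3 e4 _ _ (kmulti_kcons (tact e f) h)
  (kmulti_kcons (mact s _ _ (tact e f)) h') (kequiv_cons _ hpc).
apply: etrans (congr1 (fun F : skfun _ _ n => F x p) E) _.
apply: (congr1 (fun F : skfun _ w n => F x p)).
apply: (kskew_tot _ _ (fun w f => kcons chi f)); first by rewrite mulgA.
by rewrite !tot_hcast tot_mactM; apply: tot_mact; rewrite tot_hcast.
Qed.

Fixpoint incl_chain n (z x : C) : chain n z x -> schain n z x :=
  match n return chain n z x -> schain n z x with
  | 0%N => fun e => e
  | n'.+1 => fun c =>
      let: existT y (f, p) := c in @ccons _ (skew_cat C) n' z y x (incl1 f) (incl_chain p)
  end.

Lemma kskew_incl n t t' (z y x : C) (e : oact t y = oact t' y) (psi : kfun z (oact t y) n)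
    (c : chain n y x) :
  t' = t -> kmulti psi ->
  kskew e psi (incl_chain c) = hmor (erefl (oact t x)) (psi (oact t x) (gchain t c)).
Proof.
elim: n t' y e psi c => [|n IH] t' y e psi c et h.
  by case: x / c; apply: hmor_eq.
elim/chain_case: c => w f p; subst t'.
have e2 : oact t w = oact (t * 1)%g w by rewrite mulg1.
apply: etrans (kskew_hmorE _ _ e2 _ _ h) _.
rewrite (Prop_irrelevance e erefl).
by rewrite (IH _ _ _ (kcons psi (mact t _ _ f))) ?mulg1 //; apply: kmulti_kcons.
Qed.

Lemma rmod0 n (D : kcat k) (z y w : D) (f : hom y w) :
  rmod (fun x (_ : chain n y x) => 0 : hom z x) f = fun x (_ : chain n w x) => 0.
Proof.
apply: kfun_ext => x; case: n => [|n] c; first exact: comp0m.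
by elim/chain_case: c.
Qed.

(** Both sides of the balancing relation extend the same values of psi: the
underlying morphism of a shift is an identity, and only the degrees change. *)
Lemma kbalanced_kskew n t (z y' y : C) (e : y' = oact t y) (psi : kfun z y' n) :
  kmulti psi -> kbalanced (@is_shift k G C) (kskew e psi).
Proof.
elim: n t y' y e psi => [//|n IH] t y' y e psi h w f.
have hm := kmulti_kskew e h.
elim/shom_ind: f => [|f g [hf1 hf2] [hg1 hg2]|s w' ew f].
- rewrite (kcons0 _ hm); split; last exact: (@kbalanced0 k (skew_cat C) (@is_shift k G C) n z w).
  by move=> v g _; rewrite comp0m (kcons0 _ hm) rmod0.
- have E v (f' g' : shom y v) :
      kcons (kskew e psi) (f' + g') = klin 1 (kcons (kskew e psi) f') (kcons (kskew e psi) g').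
    by rewrite -(kcons_lin 1 f' g' hm) scale1r.
  rewrite E; split; last exact: (@kbalanced_lin k (skew_cat C) (@is_shift k G C)).
  move=> v g' hg'; rewrite compDl E -hf1 // -hg1 //.
  by apply: kfun_ext => x c; apply: rmodP.
have e2 := oact_eqM t ew; rewrite (kskew_hmor _ _ e2) //.
have hc := kmulti_kcons (tact e f) h.
split; last exact: IH.
move=> v _ [r [ev ->]].
have e3 : oact t w' = oact (t * s * r)%g v by rewrite e2 (oact_eqM _ ev).
rewrite (kskew_rmod_shift _ _ e3) //.
have e4 : oact s w = oact (s * r)%g v := oact_eqM s ev.
rewrite (hmor_comp _ _ _ _ e4) (kskew_hmor _ _ (oact_eqM t e4)) //.
apply: (kskew_tot _ _ (fun w f => kcons psi f)); first by rewrite mulgA.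
rewrite !tot_hcast; apply: tot_mact.
rewrite -[in LHS](compm1 f); apply: tot_comp => //.
by rewrite tot_hcast mact_id ew.
Qed.

(** Restriction to the part of degree 1, along the inclusion of C. *)
Definition krestr n (z y : C) (psi : skfun z y n) : kfun z y n :=
  fun x c => hcast erefl (oact1 x) (dval (psi x (incl_chain c)) 1%g).

Lemma incl1_dval (y x : C) (f : shom y x) :
  @gr k G (skew_category C) 1%g y x f -> incl1 (hcast erefl (oact1 x) (dval f 1%g)) = f.
Proof.
case=> f0 ->; rewrite /skew_of dinj_in; apply: skew_of_eq => //.
by rewrite !tot_hcast.
Qed.

Lemma multilinear_incl n (y x : C) (M : lmodType k) (phi : schain n y x -> M) :
  multilinear phi -> multilinear (fun c => phi (incl_chain c)).
Proof.
elim: n y phi => [//|n IH] y phi [h1 h2]; split=> [w p|w f].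
  by move=> a f g; rewrite /= /incl1 hmor_linear; apply: h1.
exact: (IH w (fun p => phi (@ccons _ (skew_cat C) n y w x (incl1 f) p)) (h2 w (incl1 f))).
Qed.

Lemma kmulti_krestr n (z y : C) (psi : skfun z y n) : kmulti psi -> kmulti (krestr psi).
Proof.
move=> h x.
apply: (multilinear_lin (phi := fun c => psi x (incl_chain c))
  (F := fun f => hcast erefl (oact1 x) (dval f 1%g))).
  by move=> a f g; rewrite dvalP hcast_linear.
exact: multilinear_incl.
Qed.

Lemma homog_incl n (z x : C) (c : chain n z x) :
  @homog k G (skew_category C) 1%g n z x (incl_chain c).
Proof.
elim: n z c => [//|n IH] z; elim/chain_case=> y f p.
by exists 1%g, 1%g; split; [rewrite mulg1 | apply: hmor_gr | apply: IH].
Qed.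

(** A balanced psi is determined by its restriction: each entry is a morphism of C
followed on the right by a shift, and the shifts can be carried to the right end.
The initial t plays the role of a shift in front of psi. *)
Lemma kskew_krestr n t (z y' y : C) (e : y' = oact t y) (psi : skfun z y' n) :
  kmulti psi -> @kdeg k G (skew_category C) 1%g n z y' psi ->
  kbalanced (@is_shift k G C) psi ->
  kskew e (krestr psi) = rmod psi (shift e).
Proof.
elim: n t y' y e psi => [|n IH] t y' y e psi h hd hb; apply: kfun_ext => x.
  case: x /; rewrite -[RHS]/(comp (psi y' erefl) (shift e)).
  have hg : @gr k G (skew_category C) 1%g z y' (psi y' erefl).
    by rewrite -[1%g]mulg1; apply: hd.
  by rewrite -(incl1_dval hg) -hmor_shift; apply: hmor_eq.
have hr := kmulti_krestr h.
elim/chain_case=> w f p.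
rewrite -[RHS]/(kcons psi (comp (shift e) f) p).
elim/shom_ind: f => [|f g hf hg|s w' ew f].
- by rewrite kskew_cons0 // compm0 kcons0.
- rewrite kskew_consD // compDr hf hg -[X in _ = kcons psi (X + _) p]scale1r kcons_lin //.
  by rewrite /klin scale1r.
have e2 := oact_eqM t ew; rewrite (kskew_hmorE _ _ e2) //.
have [hb1 hb2] := hb _ (incl1 (tact e f)).
rewrite -[kcons (krestr psi) _]/(krestr (kcons psi (incl1 (tact e f)))) IH //.
- rewrite hb1; last by exists (t * s)%g, e2.
  by rewrite -hmor_shift (shift_hmor _ _ _ e2).
- exact: kmulti_kcons.
- by rewrite -[1%g]mulg1; apply: kdeg_cons => //; apply: hmor_gr.
Qed.
End SkewExtension.

(** * Conjugation by homogeneous isomorphisms preserves degrees *)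
Section GradedConjugation.
Variables (k : fieldType) (G : groupType) (B : grkcat k G) (tau : B -> B).
Variables (u : forall x, hom x (tau x)) (v : forall x, hom (tau x) x) (d : B -> G).
Hypothesis u_gr : forall x, gr (d x) x (tau x) (u x).
Hypothesis v_gr : forall x, gr (d x)^-1%g (tau x) x (v x).

Lemma conj_hom_gr s (y x : B) (f : hom y x) :
  gr s y x f -> gr ((d y)^-1 * (s * d x))%g _ _ (conj_hom u v f).
Proof. by move=> hf; apply/gr_comp/gr_comp. Qed.

(** Conjugating by u_x of degree d x changes the degree s of f : x -> y into
(d y)^-1 s (d x); along a chain these factors telescope. *)
Lemma kdeg_kconj t n (z y : B) (psi : kfun z (tau y) n) :
  kdeg t psi -> kdeg (t * (d y)^-1)%g (kconj u v psi).
Proof.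
elim: n t y psi => [|n IH] t y psi h s x.
  move=> c /= ->; apply: gr_hcast; rewrite mulg1; apply: gr_comp => //.
  by rewrite -[t]mulg1; apply: h.
elim/chain_case=> w f p /homog_cons[a [b [-> hf hp]]].
have := IH _ w _ (kdeg_cons h (conj_hom_gr hf)) b x p hp.
by rewrite !mulgA mulgK.
Qed.

Lemma kdeg_khtpy t n (z y : B) (psi : kfun z (tau y) n.+1) :
  kdeg t psi -> kdeg (t * (d y)^-1)%g (khtpy u v psi).
Proof.
elim: n t y psi => [|n IH] t y psi h; first exact: kdeg_cons.
move=> s x; elim/chain_case=> w f p hc; rewrite khtpy_cons; apply: submodP.
  exact: (kdeg_cons h (v_gr y) hc).
case/homog_cons: hc => a [b [-> hf hp]].
have := IH _ w _ (kdeg_cons h (conj_hom_gr hf)) b x p hp.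
by rewrite !mulgA mulgK.
Qed.

Lemma deg_kfun n (phi : cochain B n) (z : B) : deg_preserving phi -> kdeg 1%g (@cval _ _ _ phi z).
Proof. by move=> h s x c hc; rewrite mul1g; apply: h. Qed.

Lemma deg_cconj n (phi : cochain B n) : deg_preserving phi -> deg_preserving (cconj u v phi).
Proof.
move=> h s z x c hc; have := kdeg_kconj (deg_kfun (z := tau z) h) hc.
by move=> /(gr_comp (u_gr z)); rewrite mul1g mulVKg.
Qed.

Lemma deg_chtpy n (phi : cochain B n.+1) : deg_preserving phi -> deg_preserving (chtpy u v phi).
Proof.
move=> h s z x c hc; have := kdeg_khtpy (deg_kfun (z := tau z) h) hc.
by move=> /(gr_comp (u_gr z)); rewrite mul1g mulVKg.
Qed.
End GradedConjugation.

(** * Extension of invariant cochains *)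
Lemma kmulti_cval (k : fieldType) (D : kcat k) n (phi : cochain D n) (z : D) :
  kmulti (@cval _ _ _ phi z).
Proof. by move=> x; apply: (subm_in phi). Qed.
Arguments kmulti_cval {k D n} phi z.

Section SkewCochains.
Variables (k : fieldType) (G : groupType) (C : gkcat k G).
Local Notation shom := (@hom k (skew_cat C)).
Local Notation skfun := (@kfun k (skew_cat C)).
Local Notation schain := (@chain k (skew_cat C)).

Definition skew_ext_fun n (phi : cfun C n) : cfun (skew_cat C) n :=
  fun z => kskew (esym (oact1 z)) (phi z).

Fact skew_ext_multi n (phi : cochain C n) : is_cochain (skew_ext_fun (cval phi)).
Proof. by move=> z; apply: kmulti_kskew => x; apply: (subm_in phi). Qed.

Definition skew_ext n (phi : cochain C n) : cochain (skew_cat C) n :=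
  mksub (S := cochain_submod (skew_cat C) n) (@skew_ext_multi n phi).

Lemma cval_skew_ext n (phi : cochain C n) (z : C) :
  @cval _ _ _ (skew_ext phi) z = kskew (esym (oact1 z)) (@cval _ _ _ phi z).
Proof. by []. Qed.

Lemma skew_ext_linear n : linear (@skew_ext n).
Proof.
move=> a phi psi; apply: cochain_inj => z x c; rewrite cvalP !cval_skew_ext.
have -> : @cval _ _ _ (a *: phi + psi) z =
    klin a (@cval _ _ _ phi z) (@cval _ _ _ psi z).
  by apply: kfun_ext => *; apply: cvalP.
by rewrite kskew_lin //; apply: kmulti_cval.
Qed.

Lemma kdeg_kskew n t (z y' y : C) (e : y' = oact t y) (psi : kfun z y' n) :
  kmulti psi -> @kdeg k G (skew_category C) t n z y (kskew e psi).
Proof.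
elim: n t y' y e psi => [|n IH] t y' y e psi h s x.
  by move=> c ->; rewrite mulg1; apply: hmor_gr.
elim/chain_case=> w f p /homog_cons[a [b [-> /gr_hmor[f0 ->] hp]]].
have e2 := oact_eqM t (erefl (oact a w)).
rewrite (kskew_hmorE _ _ e2) // mulgA; apply: IH => //.
exact: kmulti_kcons.
Qed.

Lemma deg_skew_ext n (phi : cochain C n) :
  @deg_preserving k G (skew_category C) n (skew_ext phi).
Proof.
move=> s z x c hc; rewrite -[s]mul1g.
exact: (kdeg_kskew (esym (oact1 z)) (kmulti_cval phi z) hc).
Qed.

Definition inv_cochain n (phi : cochain C n) := is_invariant (coch_act C n) phi.

Lemma inv_kequiv n (phi : cochain C n) s z : inv_cochain phi ->
  kequiv (s := s) (@cval _ _ _ phi z) (@cval _ _ _ phi (oact s z)).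
Proof. by move=> /(_ s) h x c; rewrite -{1}h cval_cact. Qed.

Lemma kskew_deg n t t' (z y' y : C) (e : y' = oact t y) (e' : y' = oact t' y)
    (psi : kfun z y' n) :
  t = t' -> kskew e psi = kskew e' psi.
Proof. by move=> et; case: t' / et e' => e'; rewrite (Prop_irrelevance e e'). Qed.

(** The form in which invariance is used: a shift in front of the extension of phi
becomes the initial twist of the entries of phi. *)
Lemma kcomp_shift n (phi : cochain C n) s (z' z : C) (e : z' = oact s z) :
  inv_cochain phi ->
  kcomp (shift e) (@cval _ _ _ (skew_ext phi) z) = kskew e (@cval _ _ _ phi z').
Proof.
move=> h; rewrite (Prop_irrelevance e (esym (esym e))); move: (esym e) => {e}.
move=> e; case: z' / e.
have e2 : oact s z = oact (s * 1)%g z by rewrite mulg1.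
have E := kskew_shift (esym (oact1 z)) e2 (kmulti_cval phi z)
  (kmulti_cval phi (oact s z)) (@inv_kequiv _ phi s z h).
apply: etrans E _.
by apply: kskew_deg; rewrite mulg1.
Qed.

(** In phi the twisting starts from the degree accumulated in psi; the corresponding
shift leaves phi by invariance and joins the value of psi. *)
Lemma kskew_kcup t m n (z y' y : C) (e : y' = oact t y) (psi : kfun z y' m)
    (phi : cochain C n) :
  inv_cochain phi -> kmulti psi ->
  kskew e (kcup psi (cval phi)) = kcup (kskew e psi) (cval (skew_ext phi)).
Proof.
move=> hphi; elim: m t y' y e psi => [|m IH] t y' y e psi h; apply: kfun_ext => x.
  move=> c; rewrite [RHS](kcup0 (kskew e psi)).
  rewrite (_ : kcup psi (cval phi) = kcomp (psi y' erefl) (@cval _ _ _ phi y')) //.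
  rewrite (kskew_kcomp _ e (kmulti_cval phi y')) -kcomp_shift //.
  rewrite /kcomp compA -hmor_shift; apply: (congr1 (fun g => comp g _)).
  exact: hmor_eq.
have hm := kmulti_kskew e h.
have hr : kmulti (kcup (kskew e psi) (cval (skew_ext phi))).
  by move=> x'; apply: kcup_multi => // z' x''; apply: kmulti_cval.
have hl : kmulti (kcup psi (cval phi)).
  by move=> x'; apply: kcup_multi => // z' x''; apply: kmulti_cval.
elim/chain_case=> w f p.
have [hr1 _] := hr x.
elim/shom_ind: f => [|f g hf hg|s w' ew f].
- by rewrite kskew_cons0 // (linear_0 (hr1 _ _)).
- by rewrite kskew_consD // hf hg; have := hr1 _ p 1 f g; rewrite !scale1r.
have e2 := oact_eqM t ew; rewrite (@kskew_hmorE _ _ _ (m + n) _ _ _ _ _ _ _ _ _ _ e2) //.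
rewrite (kcupS (m := m) (kskew e psi)) (kskew_hmor _ _ e2) // -IH; last exact: kmulti_kcons.
congr (kskew e2 _ p); apply: kfun_ext => x' q.
exact: (kcupS (m := m)).
Qed.

Lemma skew_ext_cup m n (psi : cochain C m) (phi : cochain C n) :
  inv_cochain phi -> skew_ext (cup psi phi) = cup (skew_ext psi) (skew_ext phi).
Proof.
move=> h; apply: cochain_inj => z x c; rewrite cval_cup !cval_skew_ext -kskew_kcup //.
exact: kmulti_cval.
Qed.

Lemma skew_ext_unit : skew_ext (cunit C) = cunit (skew_cat C).
Proof.
apply: cochain_inj => z x e; rewrite [RHS]/cval /= /unit_fun.
case: x / e => /=; apply: hmor_eq => //.
Qed.

(** Invariance enters in the leftmost summand f_(n+1) phi (f_n, ..., f_1): the shift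
contained in f_(n+1) has to cross phi.  The rest is kskew_dk. *)
Lemma skew_ext_cobd n (phi : cochain C n) :
  inv_cochain phi -> skew_ext (cobd phi) = cobd (skew_ext phi).
Proof.
move=> h; apply: cochain_inj => z x c.
rewrite cval_skew_ext !cval_cobd_kfun kskew_lin; last first.
- exact/kmulti_dk/kmulti_cval.
- by move=> x'; apply: head_multi => *; apply: kmulti_cval.
rewrite kskew_dk; last exact: kmulti_cval.
rewrite /klin; congr (_ *: _ + _).
have hh : kmulti (fun x c => head_term (cval phi) (z := z) (x := x) c).
  by move=> x'; apply: head_multi => *; apply: kmulti_cval.
have [hr _] : multilinear (@head_term _ _ _ (cval (skew_ext phi)) z x).
  by apply: head_multi => *; apply: kmulti_cval.
elim/chain_case: c => y f p.
elim/shom_ind: f => [|f g hf hg|s w' ew f].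
- by rewrite kskew_cons0 // (linear_0 (hr _ _)).
- by rewrite kskew_consD // hf hg; have := hr _ p 1 f g; rewrite !scale1r.
have e2 := oact_eqM 1%g ew; rewrite (kskew_hmorE _ _ e2) //.
rewrite -[kcons _ _]/(kcomp (tact (esym (oact1 z)) f) (@cval _ _ _ phi (oact 1%g w'))).
rewrite (kskew_kcomp _ e2 (kmulti_cval phi _)) -kcomp_shift //.
rewrite /kcomp compA -hmor_shift; apply: (congr1 (fun g => comp g _)).
apply: hmor_eq; first by rewrite mul1g.
by rewrite tot_hcast tot_mact1.
Qed.

Lemma skew_ext_inj n (phi : cochain C n) : inv_cochain phi -> skew_ext phi = 0 -> phi = 0.
Proof.
move=> h phi0; apply: (@cochain_eq_gchain _ _ _ 1%g) => z x c; rewrite cval0.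
have := kskew_incl (erefl (oact 1%g z)) c (erefl _) (kmulti_cval phi (oact 1%g z)).
rewrite -kcomp_shift // phi0 /kcomp cval0 compm0 => /esym.
by rewrite -(linear_0 (@hmor_linear _ _ _ _ _ _ _ (erefl (oact 1%g x)))) => /hmor_inj.
Qed.

(** A relative cochain is the extension of its restriction to degree 1, and this
restriction is invariant because s f and f differ by shifts on both sides. *)
Lemma skew_ext_onto n (phi : cochain (skew_cat C) n) :
  @deg_preserving k G (skew_category C) n phi ->
  (forall z, kbalanced (@is_shift k G C) (@cval _ _ _ phi z)) ->
  (forall s (z : C), rmod (@cval _ _ _ phi (oact s z)) (shift (erefl (oact s z))) =
     kcomp (shift (erefl (oact s z))) (@cval _ _ _ phi z)) ->
  exists2 psi : cochain C n, inv_cochain psi & skew_ext psi = phi.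
Proof.
move=> hd hb hl.
have psi_multi : is_cochain (fun z : C => krestr (@cval _ _ _ phi z)).
  by move=> z; apply/kmulti_krestr/kmulti_cval.
pose psi : cochain C n := mksub (S := cochain_submod C n) psi_multi.
have psi_ext t (z y : C) (e : z = oact t y) :
    kskew e (@cval _ _ _ psi z) = rmod (@cval _ _ _ phi z) (shift e).
  apply: kskew_krestr => //; first exact: kmulti_cval.
  exact: deg_kfun.
exists psi; last first.
  apply: cochain_inj => z x c; rewrite cval_skew_ext psi_ext shift1 //.
  by rewrite (rmod_idm (B := skew_cat C)).
move=> s; apply: (@cochain_eq_gchain _ _ _ s) => z x c; rewrite cval_cact.
have := kskew_incl (erefl (oact s z)) c (erefl _) (kmulti_cval psi (oact s z)).
rewrite psi_ext hl /kcomp.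
have phi1 : @gr k G (skew_category C) 1%g z x (cval phi (incl_chain c)).
  exact/hd/homog_incl.
by rewrite -(incl1_dval phi1) shift_incl1 -hmor_shift => /hmor_inj.
Qed.

Lemma kbalanced_shift1 n (z y : C) (psi : skfun z y n) :
  kmulti psi ->
  kbalanced (fun y x (f : shom y x) => exists e : y = oact 1%g x, f = shift e) psi.
Proof.
elim: n y psi => [//|n IH] y psi h w f; split; last exact/IH/kmulti_kcons.
move=> t _ [e ->]; have e' : w = t by rewrite e oact1.
case: t / e' e => e; rewrite shift1 // compm1.
by rewrite (rmod_idm (B := skew_cat C)).
Qed.
End SkewCochains.

(** * Retraction given by a free action *)
Section Transversal.
Variables (k : fieldType) (G : groupType) (C : gkcat k G).
Hypothesis freeG : free_action C.
Local Notation shom := (@hom k (skew_cat C)).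

Lemma free_oact_inj (x : C) s t : oact s x = oact t x -> s = t.
Proof.
move=> e; have : oact (t^-1 * s)%g x = x by rewrite oactM e -oactM mulVg oact1.
by move=> /freeG h; rewrite -[RHS]mulg1 -h mulVKg.
Qed.

(** The representative depends on the orbit only, because it is chosen from the
orbit as a predicate; the equation for sigma is where freeness enters. *)
Lemma orbit_transversal :
  exists (tau : C -> C) (sigma : C -> G),
    [/\ forall x, x = oact (sigma x) (tau x),
        forall s x, tau (oact s x) = tau x &
        forall s x, sigma (oact s x) = (s * sigma x)%g].
Proof.
pose orb (x y : C) : Prop := exists s : G, x = oact s y.
have orb_refl x : exists y, orb x y by exists x, 1%g; rewrite oact1.
pose tau x := projT1 (cid (orb_refl x)).
have tau_orb x : orb x (tau x) := projT2 (cid (orb_refl x)).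
have tauM s x : tau (oact s x) = tau x.
  rewrite /tau; have E : orb (oact s x) = orb x.
    apply: funext => y; apply: propext; split=> -[t e].
      exists (s^-1 * t)%g; rewrite oactM -e -oactM mulVg oact1 //.
    by exists (s * t)%g; rewrite e oactM.
  move: (orb_refl (oact s x)) (orb_refl x); rewrite E => h h'.
  by rewrite (Prop_irrelevance h h').
pose sigma x := projT1 (cid (tau_orb x)).
have sigmaP x : x = oact (sigma x) (tau x) := projT2 (cid (tau_orb x)).
exists tau, sigma; split=> // s x; apply: (@free_oact_inj (tau x)).
by rewrite -{1}(tauM s) -sigmaP oactM -sigmaP.
Qed.

Section Retraction.
Variables (tau : C -> C) (sigma : C -> G).
Hypothesis tauP : forall x, x = oact (sigma x) (tau x).
Hypothesis tauM : forall s x, tau (oact s x) = tau x.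
Hypothesis sigmaM : forall s x, sigma (oact s x) = (s * sigma x)%g.

Lemma tauVP x : tau x = oact (sigma x)^-1%g x.
Proof.
by have := congr1 (oact (sigma x)^-1%g) (tauP x); rewrite -oactM mulVg oact1 => ->.
Qed.

Let u (x : skew_cat C) : shom x (tau x) := shift (tauP x).
Let v (x : skew_cat C) : shom (tau x) x := shift (tauVP x).

Lemma uvK x : comp (u x) (v x) = idm x.
Proof.
have e : x = oact (sigma x * (sigma x)^-1)%g x by rewrite mulgV oact1.
by rewrite /u /v (shift_comp _ _ e) shift1 // mulgV.
Qed.

(** Its degree is (sigma y)^-1 s (sigma x) = 1, because sigma y = s (sigma x). *)
Lemma conj_shift s (y x : C) (e : y = oact s x) (e' : tau y = oact 1%g (tau x)) :
  conj_hom u v (shift e) = shift e'.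
Proof.
have e1 : y = oact (s * sigma x)%g (tau x) by rewrite oactM -tauP.
have e2 : tau y = oact ((sigma y)^-1 * (s * sigma x))%g (tau x).
  by rewrite oactM -e1 tauVP.
rewrite /conj_hom /u /v (shift_comp _ _ e1) (shift_comp _ _ e2); apply: hmor_eq => //.
by rewrite e sigmaM mulVg.
Qed.

Lemma tau_shift s (y x : C) : y = oact s x -> tau y = oact 1%g (tau x).
Proof. by move=> ->; rewrite tauM oact1. Qed.

Let u_gr x : @gr k G (skew_category C) (sigma x) x (tau x) (u x).
Proof. exact: hmor_gr. Qed.
Let v_gr x : @gr k G (skew_category C) (sigma x)^-1%g (tau x) x (v x).
Proof. exact: hmor_gr. Qed.

Lemma rmod_shift1 n (phi : cochain (skew_cat C) n) (y x : C) (e : y = oact 1%g x) :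
  rmod (@cval _ _ _ phi y) (shift e) = kcomp (shift e) (@cval _ _ _ phi x).
Proof.
have e' : y = x by rewrite e oact1.
case: x / e' e => e; rewrite shift1 // (rmod_idm (B := skew_cat C)).
by apply: kfun_ext => x c; rewrite /kcomp comp1m.
Qed.

(** The factor u_z enters phi by invariance, and then kconj_rmod_u applies. *)
Lemma cconj_skew_ext n (phi : cochain C n) :
  inv_cochain phi -> cconj u v (skew_ext phi) = skew_ext phi.
Proof.
move=> h; apply: cochain_inj => z x c.
rewrite -[LHS]/(kcomp (u z) (kconj u v (@cval _ _ _ (skew_ext phi) (tau z))) c).
rewrite -(kconj_kcomp u v (u z)) /u (kcomp_shift (tauP z) h).
have -> : kskew (tauP z) (@cval _ _ _ phi z) = rmod (@cval _ _ _ (skew_ext phi) z) (u z).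
  have e2 : z = oact (1 * sigma z)%g (tau z) by rewrite mul1g.
  rewrite cval_skew_ext (kskew_rmod_shift _ _ e2); last exact: kmulti_cval.
  by apply: kskew_deg; rewrite mul1g.
rewrite (kconj_rmod_u uvK (S := @is_shift k G C)) //.
  by move=> y; exists (sigma y), (tauP y).
exact/kbalanced_kskew/kmulti_cval.
Qed.

(** N turns the shifts into identities, so every cochain evaluated on N f_n, ...,
N f_1 is relative to them. *)
Lemma cconj_onto n (phi : cochain (skew_cat C) n) :
  @deg_preserving k G (skew_category C) n phi ->
  exists2 psi : cochain C n, inv_cochain psi & skew_ext psi = cconj u v phi.
Proof.
move=> hd; apply: skew_ext_onto.
- exact: (@deg_cconj k G (skew_category C) tau u v sigma u_gr v_gr n phi hd).
- move=> z; apply: kbalanced_kcomp.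
  apply: (kbalanced_kconj uvK _ (kbalanced_shift1 (kmulti_cval phi (tau z)))).
  move=> y x f [s [e ->]]; exists (tau_shift e).
  exact: conj_shift.
- move=> s z; set y := oact s z.
  have e' : tau y = oact 1%g (tau z) := tau_shift erefl.
  have cconjE w : @cval _ _ _ (cconj u v phi) w =
    kcomp (u w) (kconj u v (@cval _ _ _ phi (tau w))) by [].
  rewrite !cconjE rmod_kcomp -(kconj_rmod uvK) (conj_shift _ e').
  rewrite rmod_shift1 kconj_kcomp; apply: kfun_ext => x c.
  rewrite /kcomp compA -(conj_shift erefl e') (conj_hom_natr uvK).
  by rewrite -compA.
Qed.

Definition inv_cochains := inv_dga (hoch_action C).
Definition deg_cochains := hoch1_dga (skew_category C).

Definition skew_ext_map n (phi : inv_cochains n) : deg_cochains n :=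
  mksub (S := deg_submod (skew_category C) n) (deg_skew_ext (subm_val phi)).

Fact skew_ext_map_linear n : linear (@skew_ext_map n).
Proof.
move=> a f g; apply: subm_inj.
rewrite -[LHS]/(skew_ext (subm_val (a *: f + g))) [RHS]subm_valP subm_valP.
exact: skew_ext_linear.
Qed.
HB.instance Definition _ n :=
  GRing.isLinear.Build k (inv_cochains n) (deg_cochains n) _
    (@skew_ext_map n) (@skew_ext_map_linear n).

Definition chtpy_map n (phi : deg_cochains n.+1) : deg_cochains n :=
  mksub (S := deg_submod (skew_category C) n)
    (@deg_chtpy k G (skew_category C) tau u v sigma u_gr v_gr n _ (subm_in phi)).

Fact chtpy_map_linear n : linear (@chtpy_map n).
Proof.
move=> a f g; apply: subm_inj.
rewrite -[LHS]/(chtpy u v (subm_val (a *: f + g))) [RHS]subm_valP subm_valP.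
exact: chtpy_linear.
Qed.
HB.instance Definition _ n :=
  GRing.isLinear.Build k (deg_cochains n.+1) (deg_cochains n) _
    (@chtpy_map n) (@chtpy_map_linear n).

Lemma val_htpy n (phi : deg_cochains n) :
  subm_val (htpy (fun n => @chtpy_map n : {linear _ -> _}) phi) =
    cconj u v (subm_val phi) - subm_val phi.
Proof.
case: n phi => [|n] phi.
  exact: (cconj_htpy0 uvK (subm_val phi)).
rewrite -(cconj_htpyS uvK (subm_val phi)).
exact: subm_valD.
Qed.

Lemma skew_quasi_isom : galg_isom (cohomology inv_cochains) (cohomology deg_cochains).
Proof.
apply: (@quasi_isom k inv_cochains deg_cochains (fun n => @skew_ext_map n : {linear _ -> _})
  (fun n => @chtpy_map n : {linear _ -> _})) => /=.
- move=> n phi psi e; apply: subm_inj; apply/eqP; rewrite -subr_eq0 -subm_valB.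
  apply/eqP/skew_ext_inj; first exact: (subm_in (phi - psi)).
  have : skew_ext_map (phi - psi) = 0 by rewrite linearB; apply/eqP; rewrite subr_eq0; apply/eqP.
  by move/(congr1 (@subm_val _ _ _)).
- by apply: subm_inj; apply: skew_ext_unit.
- by move=> m n phi psi; apply: subm_inj; apply/skew_ext_cup/(subm_in psi).
- by move=> n phi; apply: subm_inj; apply/skew_ext_cobd/(subm_in phi).
- move=> n phi; have [psi psi_inv psi_phi] := cconj_onto (subm_in phi).
  exists (mksub (S := inv_sub_galg (hoch_action C) n) psi_inv); apply: subm_inj.
  by rewrite [RHS]subm_valD val_htpy addrC subrK.
- move=> n phi; apply: subm_inj; rewrite val_htpy [subm_val _]/= cconj_skew_ext ?subrr //.
  exact: (subm_in phi).
Qed.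
End Retraction.

Lemma HH1_skew : galg_isom (HH1 (skew_category C)) (coh_inv_cochains C).
Proof.
have [tau [sigma [tauP tauM sigmaM]]] := orbit_transversal.
exact: (galg_isom_sym (skew_quasi_isom tauP tauM sigmaM)).
Qed.
End Transversal.

Theorem theorem4p5 (k : fieldType) (G : groupType) (C : gkcat k G)
    (freeG : free_action C) :
  galg_isom (HH1 (skew_category C)) (coh_inv_cochains C) /\
  (invariants_exact k G -> galg_isom (HH1 (skew_category C)) (HH_inv C)).
Proof.
have iso := HH1_skew freeG; split=> // exactG.
apply: galg_isom_trans iso _.
exact: exact_coh_inv.
Qed.
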